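(* Let $p$ be a hyperbolic polynomial of degree $n$ on $\mathcal{E}$ with hyperbolicity cone $\Lambda_{++}$ and closed cone $\Lambda_+$. Assume $\Lambda_+$ is regular and $0 \le i \le n-2$. (A) The intersection $\Lambda_+ \cap \partial \Lambda^{(i)}_{+,e}$ is independent of $e \in \Lambda_{++}$ (thus, a face of $\Lambda_+$ which is a boundary face of $\Lambda^{(i)}_{+,e}$ for some $e \in \Lambda_{++}$ is a boundary face of $\Lambda^{(i)}_{+,e}$ for all $e \in \Lambda_{++}$). (B) If $e \in \Lambda_{++}$, then any boundary face of $\Lambda^{(i)}_{+,e}$ either is a face of $\Lambda_+$ or is a single ray (half-line emanating from the origin) all of whose nonzero points are contained in $\Lambda^{(i+1)}_{++,e} \setminus \Lambda^{(i-1)}_{+,e}$.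
   Context: $\mathcal{E}$ is a finite-dimensional Euclidean space. A homogeneous polynomial $p:\mathcal{E}\to\mathbb{R}$ is hyperbolic in direction $e_0\in\mathcal{E}$ if $p(e_0)>0$ and for every $x\in\mathcal{E}$ the univariate polynomial $t\mapsto p(x+te_0)$ has only real roots; $p$ is hyperbolic if it is hyperbolic in some direction $e_0$. Its hyperbolicity cone $\Lambda_{++}$ is the connected component of $\{x: p(x)>0\}$ containing $e_0$, and $\Lambda_+$ is the closure of $\Lambda_{++}$. It is known (Gårding) that $\Lambda_{++}$ is convex and that $p$ is hyperbolic in every direction $e\in\Lambda_{++}$. For $e\in\Lambda_{++}$ and $0\le i\le n-1$ ($n=\deg p$), $p_e^{(i)}(x):=D^ip(x)[e,\dots,e]$ ($i$ copies of $e$), with $p_e^{(0)}=p$; this is a polynomial of degree $n-i$ which is hyperbolic in direction $e$. $\Lambda^{(i)}_{++,e}$ is its hyperbolicity cone (the connected component of $\{p_e^{(i)}>0\}$ containing $e$) and $\Lambda^{(i)}_{+,e}$ is the closure of $\Lambda^{(i)}_{++,e}$. These cones are nested: $\Lambda_+=\Lambda^{(0)}_{+,e}\subseteq\Lambda^{(1)}_{+,e}\subseteq\cdots\subseteq\Lambda^{(n-1)}_{+,e}$. A closed convex cone is regular if it has nonempty interior and contains no linear subspace other than $\{0\}$. A boundary face of a closed convex cone is a face contained in its boundary. (For $i=0$ the first alternative in (B) always holds, so $\Lambda^{(-1)}_{+,e}$ is never needed.) *)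

(* Defs.v *)
From HB Require Import structures.
From mathcomp Require Import all_boot all_order all_algebra.
From mathcomp Require Import complex.
From mathcomp Require Import all_classical all_reals all_analysis.
(* The notations of mpoly clash with those of MathComp-Analysis. *)
From mathcomp Require Import -(notations) mpoly.

Set Implicit Arguments.
Unset Strict Implicit.
Unset Printing Implicit Defensive.

Import Order.TTheory GRing.Theory Num.Theory.
Import numFieldNormedType.Exports.

Local Open Scope classical_set_scope.
Local Open Scope ring_scope.

(* The Euclidean space is 'rV[R]_d.  Its library norm is the sup norm, but only
   the topology and the linear structure are used below. *)

Definition peval (R : realType) (d : nat) (p : mpoly d R) (x : 'rV[R]_d) : R :=
  meval (x 0) p.

(* The univariate polynomial t |-> p (x + t e). *)
Definition line_poly (R : realType) (d : nat) (p : mpoly d R)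
    (x e : 'rV[R]_d) : {poly R} :=
  mmap (@polyC R) (fun j => (x 0 j)%:P + (e 0 j)%:P * 'X) p.

Definition real_rooted (R : realType) (q : {poly R}) : Prop :=
  forall z : R[i], root (map_poly (real_complex R) q) z -> complex.Im z = 0.

Definition hyperbolic (R : realType) (d : nat) (p : mpoly d R)
    (e : 'rV[R]_d) : Prop :=
  0 < peval p e /\ forall x : 'rV[R]_d, real_rooted (line_poly p x e).

(* x |-> D^i p(x)[e, ..., e], as an iterated directional derivative; it is
   p itself for i = 0. *)
Definition dir_deriv (R : realType) (d : nat) (p : mpoly d R)
    (e : 'rV[R]_d) (i : nat) : 'rV[R]_d -> R :=
  iter i (fun f : 'rV[R]_d -> R => fun x => 'D_e f x) (peval p).

(* The hyperbolicity cone of D^i p [e, ..., e], as the component of e. *)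
Definition open_cone (R : realType) (d : nat) (p : mpoly d R)
    (e : 'rV[R]_d) (i : nat) : set 'rV[R]_d :=
  connected_component [set x | 0 < dir_deriv p e i x] e.

Definition closed_cone (R : realType) (d : nat) (p : mpoly d R)
    (e : 'rV[R]_d) (i : nat) : set 'rV[R]_d :=
  closure (open_cone p e i).

Definition boundary (T : topologicalType) (A : set T) : set T :=
  closure A `\` interior A.

(* Only applied to closed hyperbolicity cones, which are closed and convex. *)
Definition regular_cone (R : realType) (d : nat) (K : set 'rV[R]_d) : Prop :=
  interior K !=set0 /\
  forall V : {vspace 'rV[R]_d}, [set` V] `<=` K -> V = 0%VS.

Definition face (R : realType) (d : nat) (K F : set 'rV[R]_d) : Prop :=
  [/\ F `<=` K, convex_set F &
      forall (x y : 'rV[R]_d) (t : R), K x -> K y -> 0 < t -> t < 1 ->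
        F (t *: x + (1 - t) *: y) -> F x /\ F y].

Definition boundary_face (R : realType) (d : nat) (K F : set 'rV[R]_d) : Prop :=
  face K F /\ F `<=` boundary K.

Definition ray (R : realType) (d : nat) (F : set 'rV[R]_d) : Prop :=
  exists2 v : 'rV[R]_d, v != 0 & F = [set t *: v | t in [set t : R | 0 <= t]].

(* Main.v *)
(** Write c_j(x) for the coefficients of t |-> p (x + t e), so that D^j p(x)[e,...,e]
    is j! c_j(x). For a real-rooted polynomial a vanishing coefficient lies
    between coefficients of opposite signs (Laguerre), unless all coefficients
    below it vanish. Hence the cone of order i consists of the x with
    c_j(x) >= 0 for all j >= i, its boundary is cut out by c_i(x) = 0, and for
    i >= 1 a boundary point either has c_{i-1}(x) < 0, with 0 a simple root
    of the i-th derivative, or lies in the original cone with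
    c_0(x) = ... = c_i(x) = 0.

    The second case means that p vanishes to order > i at x along e; by
    monotonicity of p along directions of the cone this order does not depend on
    e, which gives (A). For (B), take two points a, c of a boundary face: the
    i-th derivative vanishes on the plane they span. Leaving the cone of order
    i inside this plane, from a in direction -c, one exits at a point where
    c_{i-1} >= 0, that is, at a point of the original cone. So a and c are
    nonnegative combinations of points of the original cone, unless they are
    proportional.

    Convexity and independence of the direction are Garding's theorem: the roots
    z of p (s x + i e + z v) never cross the real axis as s varies and lie in the
    lower half plane for s = 0. *)
Require Import Defs.
From HB Require Import structures.
From mathcomp Require Import all_boot all_order all_algebra.
From mathcomp Require Import ring lra zify.
From mathcomp Require Import complex.
From mathcomp Require Import all_classical all_reals all_analysis.
From mathcomp Require Import -(notations) mpoly.

Set Implicit Arguments.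
Unset Strict Implicit.
Unset Printing Implicit Defensive.

Import Order.TTheory GRing.Theory Num.Theory.
Import numFieldNormedType.Exports.

Local Open Scope classical_set_scope.
Local Open Scope ring_scope.

(** * Real-rooted polynomials *)

Section RealRooted.
Variable R : realType.
Implicit Types (q : {poly R}) (s : seq R).

(** Squared modulus with values in [R], so that the estimates below are real inequalities. *)
Definition normsqc (z : R[i]) : R := complex.Re z ^+ 2 + complex.Im z ^+ 2.

Lemma normsqc_ge0 z : 0 <= normsqc z.
Proof. by rewrite addr_ge0 ?sqr_ge0. Qed.

Lemma normsqcN z : normsqc (- z) = normsqc z.
Proof. by case: z => a b; rewrite /normsqc /= !sqrrN. Qed.

Lemma normsqcM z w : normsqc (z * w) = normsqc z * normsqc w.
Proof. by case: z w => a b [c d]; rewrite /normsqc /=; ring. Qed.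

Lemma normsqcD z w : normsqc (z + w) <= 2 * normsqc z + 2 * normsqc w.
Proof.
case: z w => a b [c d]; rewrite /normsqc /=.
have := sqr_ge0 (a - c); have := sqr_ge0 (b - d); nra.
Qed.

Lemma normsqc_eq0 z : (normsqc z == 0) = (z == 0).
Proof.
by case: z => a b; rewrite /normsqc /= paddr_eq0 ?sqr_ge0 // !sqrf_eq0 eq_complex.
Qed.

Lemma normsqc_gt0 z : (0 < normsqc z) = (z != 0).
Proof. by rewrite lt0r normsqc_ge0 andbT normsqc_eq0. Qed.

Lemma normsqc_real (c : R) : normsqc (real_complex R c) = c ^+ 2.
Proof. by rewrite /normsqc /= expr0n addr0. Qed.

Lemma complex_split (q : {poly R[i]}) :
  exists s : seq R[i], q = lead_coef q *: \prod_(z <- s) ('X - z%:P).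
Proof.
have [s e] := closed_field_poly_normal q; exists s; exact: e.
Qed.

Lemma real_rooted_split q : real_rooted q ->
  exists s, q = lead_coef q *: \prod_(r <- s) ('X - r%:P).
Proof.
move=> rr; have [s Es] := complex_split (map_poly (real_complex R) q).
have [->|q0] := eqVneq q 0; first by exists nil; rewrite lead_coef0 scale0r.
have lc0 : lead_coef (map_poly (real_complex R) q) != 0.
  by rewrite lead_coef_eq0 map_poly_eq0.
exists (map (@complex.Re R) s); apply: (@map_poly_inj _ _ (real_complex R)).
rewrite {1}Es lead_coef_map map_polyZ rmorph_prod /= big_map; congr (_ *: _).
apply: eq_big_seq => z zs; rewrite map_polyXsubC; congr ('X - _%:P).
have /rr : root (map_poly (real_complex R) q) z.
  by rewrite Es rootZ // root_prod_XsubC.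
by case: (z) => a b /= ->.
Qed.

(** Induction on the roots: a new factor X - r turns f'^2 - f f'' at 0 into g(0)^2 + r^2 (g'(0)^2 -
    g(0) g''(0)), where g is the old product. *)
Lemma prod_XsubC_laguerre s (f := \prod_(r <- s) ('X - r%:P)) :
  0 <= f^`().[0] ^+ 2 - f.[0] * f^`()^`().[0] /\
  (s != [::] -> f.[0] != 0 -> 0 < f^`().[0] ^+ 2 - f.[0] * f^`()^`().[0]).
Proof.
rewrite {}/f; elim: s => [|r s [IH _]].
  by rewrite big_nil derivC deriv0 !hornerE; split=> //; lra.
rewrite big_cons; set g := \prod_(j <- s) _ in IH *.
have -> : (('X - r%:P) * g)^`().[0] ^+ 2 -
    (('X - r%:P) * g).[0] * (('X - r%:P) * g)^`()^`().[0] =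
  g.[0] ^+ 2 + r ^+ 2 * (g^`().[0] ^+ 2 - g.[0] * g^`()^`().[0]).
  have d1 h : (('X - r%:P) * h)^`() = h + ('X - r%:P) * h^`().
    by rewrite derivM derivXsubC mul1r.
  by rewrite d1 derivD d1 !hornerE /=; ring.
have h : 0 <= r ^+ 2 * (g^`().[0] ^+ 2 - g.[0] * g^`()^`().[0]).
  by rewrite mulr_ge0 ?sqr_ge0.
split=> [|_]; first by rewrite addr_ge0 ?sqr_ge0.
rewrite hornerM mulf_eq0 negb_or => /andP[_ g0].
by rewrite ltr_pwDl // lt0r sqrf_eq0 g0 sqr_ge0.
Qed.

(** Up to the factor |f(z)|^2 this is the sign of Im (f'/f)(z). As f'/f is the sum of the 1/(z - r),
    whose imaginary parts have the sign opposite to Im z, the derivative of a nonconstant f has no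
    nonreal zero. *)
Lemma prod_XsubC_gauss_lucas s (z : R[i])
    (f := \prod_(r <- s) ('X - (real_complex R r)%:P)) :
  complex.Im z != 0 ->
  f.[z] != 0 /\
  complex.Im (f^`().[z] * conjc f.[z]) * complex.Im z <= 0 /\
  (s != [::] -> complex.Im (f^`().[z] * conjc f.[z]) * complex.Im z < 0).
Proof.
rewrite {}/f; case: z => a b /= b0; elim: s => [|r s [g0 [IH _]]].
  rewrite big_nil derivC !hornerE /=; split; first exact: oner_neq0.
  by split => //; lra.
rewrite big_cons; set g := \prod_(j <- s) _ in g0 IH *.
have b2 : 0 < b ^+ 2 by rewrite lt0r sqrf_eq0 b0 sqr_ge0.
have zr : Complex a b - real_complex R r != 0.
  by rewrite eq_complex /= subr0 negb_and b0 orbT.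
have gz : 0 < normsqc g.[Complex a b] by rewrite normsqc_gt0.
have E : complex.Im ((('X - (real_complex R r)%:P) * g)^`().[Complex a b] *
    conjc (('X - (real_complex R r)%:P) * g).[Complex a b]) * b =
  - (b ^+ 2 * normsqc g.[Complex a b]) +
   ((a - r) ^+ 2 + b ^+ 2) *
    (complex.Im (g^`().[Complex a b] * conjc g.[Complex a b]) * b).
  rewrite !(derivM, derivXsubC) !hornerE.
  case: (g.[_]) (g^`().[_]) => u v [u' v']; rewrite /normsqc /=; ring.
have h : ((a - r) ^+ 2 + b ^+ 2) *
    (complex.Im (g^`().[Complex a b] * conjc g.[Complex a b]) * b) <= 0.
  by rewrite mulr_ge0_le0 // addr_ge0 ?sqr_ge0.
have lt0 : complex.Im ((('X - (real_complex R r)%:P) * g)^`().[Complex a b] *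
    conjc (('X - (real_complex R r)%:P) * g).[Complex a b]) * b < 0.
  by rewrite E; have := mulr_gt0 b2 gz; lra.
split; last by split=> //; rewrite ltW.
by rewrite hornerM mulf_neq0 // !hornerE.
Qed.

Lemma horner_ge0 q t : (forall j, 0 <= q`_j) -> 0 <= t -> 0 <= q.[t].
Proof.
by move=> q_ge0 t0; rewrite horner_coef sumr_ge0 // => j _; rewrite mulr_ge0 ?exprn_ge0.
Qed.

Lemma horner_ge_coef0 q t : (forall j, 0 <= q`_j) -> 0 <= t -> q`_0 <= q.[t].
Proof.
elim/poly_ind: q => [|q c _] q_ge0 t0; first by rewrite horner0 coef0.
rewrite hornerMXaddC coefD coefMX coefC /= add0r lerDr mulr_ge0 //.
apply: horner_ge0 => // j.
by have := q_ge0 j.+1; rewrite coefD coefMX coefC /= addr0.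
Qed.

Lemma horner_gt0 q t : (forall j, 0 <= q`_j) -> q != 0 -> 0 < t -> 0 < q.[t].
Proof.
move=> q_ge0 q0 t0; have : lead_coef q != 0 by rewrite lead_coef_eq0.
rewrite horner_coef lead_coefE; case: (size q) (polySpred q0) => // k _ qk.
rewrite big_ord_recr /= ltr_wpDl //.
  by rewrite sumr_ge0 // => j _; rewrite mulr_ge0 // exprn_ge0 // ltW.
by rewrite mulr_gt0 ?exprn_gt0 // lt0r qk q_ge0.
Qed.

Lemma real_rooted_neq0 q : real_rooted q -> q != 0.
Proof.
move=> rr; apply/eqP => q0.
have := rr (Complex 0 1); rewrite q0 map_poly0 root0 /= => /(_ isT) /eqP.
by rewrite oner_eq0.
Qed.

Lemma real_rooted_deriv q : real_rooted q -> (1 < size q)%N ->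
  real_rooted q^`().
Proof.
move=> rr sq z; have [s Es] := real_rooted_split rr.
have [//|z0] := eqVneq (complex.Im z) 0.
have s0 : s != [::].
  apply: contraTneq sq => s0; rewrite Es s0 big_nil -leqNgt.
  by rewrite (leq_trans (size_scale_leq _ _)) // size_poly1.
have [_ [_ /(_ s0)]] := prod_XsubC_gauss_lucas s z0.
set f := (X in X^`()) => lt0.
rewrite Es derivZ map_polyZ /= rootZ; last first.
  by rewrite fmorph_eq0 lead_coef_eq0 real_rooted_neq0.
have -> : map_poly (real_complex R) (\prod_(r <- s) ('X - r%:P))^`() = f^`().
  by rewrite -deriv_map map_prod_XsubC.
by move=> /rootP fz; move: lt0; rewrite fz mul0r /= mul0r ltxx.
Qed.

Lemma size_derivn_gt1 q k : (k.+1 < size q)%N -> (1 < size q^`(k))%N.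
Proof.
move=> kq; have q0 : q != 0.
  by apply/eqP => q0; move: kq; rewrite q0 size_poly0.
have : (q^`(k))`_((size q).-1 - k) != 0.
  rewrite coef_derivn subnKC; last by lia.
  rewrite -mulr_natr mulf_neq0 //.
    by rewrite -lead_coefE lead_coef_eq0.
  by rewrite pnatr_eq0 -lt0n ffact_gt0; lia.
apply: contraNT; rewrite -leqNgt => h; rewrite nth_default //.
by apply: leq_trans h _; lia.
Qed.

Lemma real_rooted_derivn q k : real_rooted q -> (k < size q)%N ->
  real_rooted q^`(k).
Proof.
move=> rr; elim: k => [//|k IH] kq; rewrite derivnS.
apply: real_rooted_deriv; first by apply: IH; exact: ltnW.
exact: size_derivn_gt1.
Qed.

(* Laguerre's inequality at 0 for the derivative of order j - 1. *)
Lemma real_rooted_coef_gap q j : real_rooted q -> (0 < j < size q)%N ->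
  q`_j = 0 -> q`_j.-1 != 0 -> q`_j.-1 * q`_j.+1 < 0.
Proof.
case: j => // j rr /= jq qj0 qj.
have rr' : real_rooted q^`(j) by apply: real_rooted_derivn => //; exact: ltnW.
have [s Es] := real_rooted_split rr'.
have fact0 k : (0 : R) < k`!%:R by rewrite ltr0n fact_gt0.
have f0 : q^`(j).[0] = j`!%:R * q`_j.
  by rewrite horner_coef0 coef_derivn addn0 ffactnn mulr_natl.
have f1 : q^`(j)^`().[0] = 0.
  by rewrite -derivnS horner_coef0 coef_derivn addn0 qj0 mul0rn.
have f2 : q^`(j)^`()^`().[0] = j.+2`!%:R * q`_j.+2.
  by rewrite -!derivnS horner_coef0 coef_derivn addn0 ffactnn mulr_natl.
have [_] := prod_XsubC_laguerre s; set f := \prod_(r <- s) _.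
set c := lead_coef _ in Es.
have fne : q^`(j).[0] != 0 by rewrite f0 mulf_neq0 // gt_eqF.
have c0 : c != 0 by rewrite lead_coef_eq0 real_rooted_neq0.
move: f0 f1 f2 fne; rewrite Es !derivZ !hornerZ => f0 f1 f2 fne lag.
have s0 : s != [::].
  have := size_derivn_gt1 jq; apply: contraTneq => s0.
  rewrite Es s0 big_nil -leqNgt.
  by rewrite (leq_trans (size_scale_leq _ _)) // size_poly1.
have fne' : f.[0] != 0 by move: fne; rewrite mulf_eq0 negb_or => /andP[].
have f1' : f^`().[0] = 0 by apply/eqP; move/eqP: f1; rewrite mulf_eq0 (negPf c0).
move: lag => /(_ s0 fne'); rewrite f1' expr0n /= add0r oppr_gt0 => ff.
have : (c * f.[0]) * (c * f^`()^`().[0]) < 0.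
  rewrite mulrACA -expr2 pmulr_rlt0 // lt0r sqrf_eq0 c0; exact: sqr_ge0.
by rewrite f0 f2 mulrACA pmulr_rlt0 // mulr_gt0.
Qed.

(** Were the next lower coefficient nonzero, [real_rooted_coef_gap] would make a product with a
    vanishing factor negative; the induction then descends. *)
Lemma real_rooted_coef_eq0 q j : real_rooted q -> (j.+1 < size q)%N ->
  q`_j = 0 -> q`_j.+1 = 0 -> forall k, (k <= j.+1)%N -> q`_k = 0.
Proof.
move=> rr; elim: j => [|j IH] jq q0 q1 k.
  by case: k => [|[|k]].
rewrite leq_eqVlt => /predU1P[->//|kj].
apply: IH => //; first exact: ltnW.
apply/eqP; apply/negPn/negP => h.
have := @real_rooted_coef_gap q j.+1 rr _ q0 h.
by rewrite q1 mulr0 ltxx; move=> /(_ (ltnW jq)).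
Qed.

(** The first zero after a positive coefficient would have to be followed by a negative one. *)
Lemma real_rooted_coef_gt0 q : real_rooted q -> (forall j, 0 <= q`_j) ->
  0 < q`_0 -> forall j, (j < size q)%N -> 0 < q`_j.
Proof.
move=> rr q_ge0 q0 j; elim: j => // j IH jq.
rewrite lt0r q_ge0 andbT; apply/eqP => qj.
have qj_gt0 := IH (ltnW jq).
have := @real_rooted_coef_gap q j.+1 rr jq qj (lt0r_neq0 qj_gt0).
by rewrite pmulr_rlt0 // ltNge q_ge0.
Qed.

(* When the coefficients above i are nonnegative and that of index i + 1
   vanishes, the sign of the i-th one tells whether 0 is a multiple root of the
   (i+1)-st derivative. *)
Lemma real_rooted_coef_ge0 q i : real_rooted q -> (i.+2 < size q)%N ->
  (forall j, (i < j)%N -> 0 <= q`_j) -> q`_i.+1 = 0 -> 0 <= q`_i ->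
  forall j, (j <= i.+1)%N -> q`_j = 0.
Proof.
move=> rr iq ge0 qi1 qi.
have [qi0|qi0] := eqVneq q`_i 0.
  by apply: real_rooted_coef_eq0 => //; exact: ltnW.
have := @real_rooted_coef_gap q i.+1 rr (ltnW iq) qi1 qi0.
by rewrite ltNge mulr_ge0 // ge0.
Qed.

(** Across the gap at i+1 the sign changes, so the coefficient of index i+2 is positive; from there
    positivity propagates upwards. *)
Lemma real_rooted_coef_simple q i : real_rooted q -> (i.+2 < size q)%N ->
  (forall j, (i < j)%N -> 0 <= q`_j) -> q`_i.+1 = 0 -> q`_i < 0 ->
  forall j, (i.+1 < j < size q)%N -> 0 < q`_j.
Proof.
move=> rr iq ge0 qi1 qi j /andP[ij jq].
have qi0 : q`_i != 0 by rewrite lt_eqF.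
have q2 : 0 < q`_i.+2.
  by have := @real_rooted_coef_gap q i.+1 rr (ltnW iq) qi1 qi0; rewrite nmulr_rlt0.
elim: j ij jq => // j IH; rewrite ltnS leq_eqVlt => /predU1P[<-//|ij] jq.
have qj := IH ij (ltnW jq).
rewrite lt0r ge0; last by lia.
rewrite andbT; apply/eqP => qj1.
have := @real_rooted_coef_gap q j.+1 rr jq qj1 (lt0r_neq0 qj).
by rewrite pmulr_rlt0 // ltNge ge0 //; lia.
Qed.

Lemma horner_ge_coef q k t : (forall j, 0 <= q`_j) -> 0 <= t ->
  q`_k * t ^+ k <= q.[t].
Proof.
move=> q_ge0 t0; have [kq|qk] := ltnP k (size q); last first.
  by rewrite nth_default // mul0r horner_ge0.
rewrite horner_coef (bigD1 (Ordinal kq)) //= lerDl sumr_ge0 // => j _.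
by rewrite mulr_ge0 ?exprn_ge0.
Qed.

Lemma horner_le_expr q k t : (forall j, 0 <= q`_j) ->
  (forall j, (j < k)%N -> q`_j = 0) -> 0 <= t -> t <= 1 ->
  q.[t] <= q.[1] * t ^+ k.
Proof.
move=> q_ge0 q0 t0 t1; rewrite !horner_coef mulr_suml; apply: ler_sum => j _.
have [/q0 ->|kj] := ltnP j k; first by rewrite !mul0r.
by rewrite expr1n mulr1 ler_wpM2l // ler_wiXn2l.
Qed.

Lemma poly_eq0_itv q : (forall t, 0 < t -> t < 1 -> q.[t] = 0) -> q = 0.
Proof.
(* As many roots as [size q]: the points 1/(k+2), where the shift by 2 keeps them strictly below
   1. *)
move=> H; pose s := [seq k.+2%:R^-1 : R | k <- iota 0 (size q)].
apply: (@roots_geq_poly_eq0 _ _ s).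
- apply/allP => _ /mapP[k _ ->]; apply/rootP/H; first by rewrite invr_gt0 ltr0n.
  by rewrite invf_lt1 ?ltr0n // ltr1n.
- rewrite map_inj_uniq ?iota_uniq // => k l /invr_inj/eqP.
  by rewrite eqr_nat => /eqP[].
- by rewrite size_map size_iota.
Qed.

End RealRooted.

(** * Restriction of a multivariate polynomial to lines *)

Section MpolyMorph.
Variables (R A : comNzRingType) (d : nat) (f : {rmorphism R -> A}).
Implicit Types (p : mpoly d R) (m : multinom d) (a b h : 'I_d -> A).

Lemma mmap_eq (B : comNzRingType) (g1 g2 : R -> B) (h1 h2 : 'I_d -> B) p :
  g1 =1 g2 -> h1 =1 h2 -> mmap g1 h1 p = mmap g2 h2 p.
Proof.
move=> eg eh; rewrite /mmap; apply: eq_bigr => m _.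
by rewrite eg (mmap1_eq _ eh).
Qed.

Lemma rmorph_mmap (B : comNzRingType) (g : {rmorphism A -> B}) h p :
  g (mmap f h p) = mmap (g \o f) (g \o h) p.
Proof.
rewrite /mmap rmorph_sum; apply: eq_bigr => m _.
rewrite rmorphM; congr (_ * _); rewrite /mmap1 rmorph_prod.
by apply: eq_bigr => j _; rewrite rmorphXn.
Qed.

Lemma mmap_homog p n h (c : A) : p \is ishomog1 n mdeg ->
  mmap f (fun j => c * h j) p = c ^+ n * mmap f h p.
Proof.
move=> /dhomogP hp; rewrite /mmap mulr_sumr; apply: eq_big_seq => m mp.
have <- : mdeg m = n := hp m mp.
rewrite mulrCA; congr (_ * _); rewrite /mmap1 mdegE.
rewrite -[X in X * _]prodrXr -big_split /=.
by apply: eq_bigr => j _; rewrite exprMn.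
Qed.

End MpolyMorph.

Section MpolyLine.
Variables (R A : comNzRingType) (d : nat) (f : {rmorphism R -> A}).
Implicit Types (p : mpoly d R) (m : multinom d) (a b h : 'I_d -> A).

Let line a b j : {poly A} := (a j)%:P + (b j)%:P * 'X.

Lemma horner_mmap_line p a b c :
  (mmap (polyC \o f) (fun j => (a j)%:P + (b j)%:P * 'X) p).[c] =
  mmap f (fun j => a j + b j * c) p.
Proof.
rewrite -[LHS]/(horner_eval c _) rmorph_mmap.
apply: mmap_eq => [r|j] /=; rewrite /horner_eval ?hornerC //.
by rewrite hornerD hornerMX !hornerC.
Qed.

(** A formal degree: allowing the leading coefficient [c] to vanish makes the notion multiplicative
    over any commutative ring. *)
Let deg_at k (u : {poly A}) c := (size u <= k.+1)%N /\ u`_k = c.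

Let deg_atM k u c l v e :
  deg_at k u c -> deg_at l v e -> deg_at (k + l) (u * v) (c * e).
Proof.
move=> [su <-] [sv <-]; split.
  by apply: leq_trans (size_polyMleq _ _) _; lia.
rewrite coefM (bigD1 (Ordinal (leq_addr l k : (k < (k + l).+1)%N))) //=.
rewrite addKn big1 ?addr0 // => j jk.
have {}jk : (j : nat) != k by [].
have [jk'|kj] := ltnP j k; last first.
  by rewrite nth_default ?mul0r // (leq_trans su) // ltn_neqAle eq_sym jk kj.
by rewrite (nth_default _ (_ : size v <= _)%N) ?mulr0 //; lia.
Qed.

(** Each factor a_j + b_j X has formal degree 1 and leading coefficient b_j, so a monomial of degree
    n yields formal degree n and its own value at b. *)
Lemma size_coef_mmap_line p n a b : p \is ishomog1 n mdeg ->
  let q := mmap (polyC \o f) (fun j => (a j)%:P + (b j)%:P * 'X) p in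
  (size q <= n.+1)%N /\ q`_n = mmap f b p.
Proof.
move=> /dhomogP hp.
have D j k : deg_at k (line a b j ^+ k) (b j ^+ k).
  elim: k => [|k IH]; first by rewrite !expr0; split; rewrite ?size_poly1 ?coef1.
  rewrite !exprS -add1n; apply: deg_atM IH; split.
    apply: leq_trans (size_polyD _ _) _; rewrite geq_max.
    rewrite (leq_trans (size_polyC_leq1 _)) //=.
    apply: leq_trans (size_polyMleq _ _) _.
    by rewrite size_polyX addn2 ltnS size_polyC_leq1.
  by rewrite coefD coefC coefMX coefC add0r.
have {}D m : m \in msupp p -> deg_at n (mmap1 (line a b) m) (mmap1 b m).
  move=> mp; have <- : mdeg m = n := hp m mp.
  rewrite mdegE /mmap1.
  elim/big_rec3: _ => [|j x y z _ IH]; last exact: deg_atM.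
  by split; rewrite ?size_poly1 ?coef1.
split.
  rewrite /mmap big_seq; elim/big_rec: _ => [|m q mp IH].
    by rewrite size_poly0.
  rewrite (leq_trans (size_polyD _ _)) // geq_max IH andbT mul_polyC.
  by rewrite (leq_trans (size_scale_leq _ _)) //; case: (D m mp).
rewrite /mmap coef_sum; apply: eq_big_seq => m mp.
by rewrite mul_polyC coefZ; case: (D m mp) => _ ->.
Qed.

(** Chain rule. The identity is linear in [p] and stable under products, so it suffices to check it
    on 1 and on the variables. *)
Lemma deriv_mmap p (h : 'I_d -> {poly A}) :
  (mmap (polyC \o f) h p)^`() =
  \sum_j (h j)^`() * mmap (polyC \o f) h (mderiv j p).
Proof.
elim/mpolyind: p => [|c m p _ _ IH].
  rewrite mmap0 deriv0 big1 // => j _; by rewrite mderiv0 mmap0 mulr0.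
rewrite mmapD derivD IH.
under [RHS]eq_bigr do rewrite mderivD mmapD mulrDr.
rewrite big_split /=; congr (_ + _).
rewrite mmapZ /= mul_polyC derivZ.
under [RHS]eq_bigr do rewrite mderivZ mmapZ /= mul_polyC -scalerAr.
rewrite -scaler_sumr; congr (_ *: _).
pose Q p := (mmap (polyC \o f) h p)^`() =
  \sum_j (h j)^`() * mmap (polyC \o f) h (mderiv j p).
have QM u v : Q u -> Q v -> Q (u * v).
  rewrite /Q => Qu Qv; rewrite rmorphM derivM Qu Qv mulr_suml mulr_sumr.
  rewrite -big_split /=; apply: eq_bigr => j _.
  by rewrite mderivM mmapD !rmorphM /=; ring.
have Q1 : Q 1.
  rewrite /Q rmorph1 -polyC1 derivC big1 // => j _.
  by rewrite mderivC mmap0 mulr0.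
have QX i : Q (mpolyX R (mnm1 i)).
  rewrite /Q mmapX mmap1U (bigD1 i) //= big1 => [|j ji].
    rewrite addr0 mderivX mnm1E eqxx scale1r.
    have -> : mnm_sub (mnm1 i) (mnm1 i) = mnm0 :> multinom d.
      by apply/mnmP => k; rewrite mnmBE subnn mnm0E.
    by rewrite mpolyX0 rmorph1 mulr1.
  by rewrite mderivX mnm1E eq_sym (negPf ji) scale0r mmap0 mulr0.
rewrite -/(Q _) mpolyXE_id.
apply: (big_ind Q) => // i _.
by elim: (m i) => [|k IHk]; rewrite ?expr0 // exprS; apply: QM.
Qed.

End MpolyLine.

(** * Directional derivatives as coefficients along a line *)

Section DirectionalDerivative.
Variables (R : realType) (d : nat).
Implicit Types (p : mpoly d R) (x e : 'rV[R]_d).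

(** Formal directional derivative, which keeps the iterates polynomial and homogeneous; [dir_derivE]
    identifies them with the analytic ones. *)
Definition mdir e p : mpoly d R := \sum_j e 0 j *: mderiv j p.

Lemma mdir_homog p e n : p \is ishomog1 n mdeg ->
  mdir e p \is ishomog1 n.-1 mdeg.
Proof.
move=> hp; apply: rpred_sum => j _; apply: rpredZ.
apply/dhomogP => m; rewrite mcoeff_msupp mcoeff_mderiv => h.
have : mnm_add m (mnm1 j) \in msupp p.
  by rewrite mcoeff_msupp; apply: contraNneq h => ->; rewrite mul0rn.
by move=> /(dhomogP _ _ _ hp) <-; rewrite /= mdegD mdeg1 addn1.
Qed.

Lemma iter_mdir_homog p e n k : p \is ishomog1 n mdeg ->
  iter k (mdir e) p \is ishomog1 (n - k) mdeg.
Proof.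
move=> hp; elim: k => [|k IH]; first by rewrite subn0.
by rewrite iterS subnS; apply: mdir_homog.
Qed.

Lemma line_poly_mdir p x e : line_poly (mdir e p) x e = (line_poly p x e)^`().
Proof.
rewrite /line_poly [RHS](deriv_mmap idfun p) /mdir raddf_sum; apply: eq_bigr => j _ /=.
by rewrite mmapZ derivD derivC add0r deriv_mulC derivX mulr1.
Qed.

Lemma line_poly_iter_mdir p x e k :
  line_poly (iter k (mdir e) p) x e = (line_poly p x e)^`(k).
Proof. by elim: k => //= k IH; rewrite line_poly_mdir IH. Qed.

Lemma horner_line_poly p x e t : (line_poly p x e).[t] = peval p (x + t *: e).
Proof.
rewrite /line_poly /peval /meval.
rewrite (@horner_mmap_line _ _ _ idfun p (x 0) (e 0) t).
by apply: mmap_eq => // j; rewrite !mxE mulrC.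
Qed.

Lemma peval_line_poly p x e : peval p x = (line_poly p x e)`_0.
Proof. by rewrite -horner_coef0 horner_line_poly scale0r addr0. Qed.

Lemma peval_iter_mdir p x e k :
  peval (iter k (mdir e) p) x = (line_poly p x e)`_k *+ k`!.
Proof.
by rewrite (peval_line_poly _ _ e) line_poly_iter_mdir coef_derivn addn0 ffactnn.
Qed.

Lemma peval_homog p x n c : p \is ishomog1 n mdeg ->
  peval p (c *: x) = c ^+ n * peval p x.
Proof.
move=> hp; rewrite /peval /meval -(mmap_homog idfun (x 0) c hp).
by apply: mmap_eq => // j; rewrite mxE.
Qed.

Lemma size_line_poly p x e n : p \is ishomog1 n mdeg ->
  (size (line_poly p x e) <= n.+1)%N.
Proof. by case/(size_coef_mmap_line idfun (x 0) (e 0)). Qed.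

Lemma coef_line_poly_top p x e n : p \is ishomog1 n mdeg ->
  (line_poly p x e)`_n = peval p e.
Proof. by case/(size_coef_mmap_line idfun (x 0) (e 0)). Qed.

(** The quotient defining the derivative along e at x is the difference quotient of [line_poly] at
    0. *)
Lemma dir_derivE p e k x : dir_deriv p e k x = peval (iter k (mdir e) p) x.
Proof.
elim: k x => // k IH x; rewrite /dir_deriv iterS -/(dir_deriv p e k).
have -> : dir_deriv p e k = peval (iter k (mdir e) p) by apply/funext.
rewrite iterS; set q := iter k _ _.
rewrite (peval_line_poly _ _ e) line_poly_mdir -horner_coef0 derivE derive1E /derive.
set F := (X in fmap X _); set G := (X in _ = lim (fmap X _)).
have -> // : F = G.
apply/funext => h; rewrite /F /G /=.
by rewrite !horner_line_poly addr0 scale0r addr0 [h *: 1]mulr1 [x + _]addrC.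
Qed.

End DirectionalDerivative.

(** * Garding's theorem *)

Section ComplexBounds.
Variable R : realType.
Local Notation C := (complex R).
Local Notation rc := (real_complex R).
Implicit Types (P : {poly C}) (z : C).

Lemma lower_half_plane_split P k : size P = k.+1 ->
  (forall w, 0 <= complex.Im w -> P.[w] != 0) ->
  exists s : seq C, [/\ P = lead_coef P *: \prod_(z <- s) ('X - z%:P),
    size s = k & forall w, w \in s -> complex.Im w < 0].
Proof.
move=> sP nr; have [s Es] := complex_split P.
have P0 : P != 0 by rewrite -size_poly_eq0 sP.
have lP : lead_coef P != 0 by rewrite lead_coef_eq0.
exists s; split=> [//||w ws].
  by apply/succn_inj; rewrite -sP Es size_scale // size_prod_XsubC.
rewrite ltNge; apply/negP => /nr; rewrite Es hornerZ.
have /rootP -> : root (\prod_(z <- s) ('X - z%:P)) w by rewrite root_prod_XsubC.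
by rewrite mulr0 eqxx.
Qed.

(** All roots lie below the real axis, so each is at distance at least Im z from z. The bound
    involves only the leading coefficient of [P], hence is uniform in a family where that
    coefficient is fixed. *)
Lemma lower_bound_closed P k z : size P = k.+1 ->
  (forall w, 0 <= complex.Im w -> P.[w] != 0) -> 0 <= complex.Im z ->
  normsqc P`_k * (complex.Im z ^+ 2) ^+ k <= normsqc P.[z].
Proof.
move=> sP nr z0; have [s [Es ss sn]] := lower_half_plane_split sP nr.
have -> : P`_k = lead_coef P by rewrite lead_coefE sP.
rewrite {2}Es hornerZ normsqcM ler_wpM2l ?normsqc_ge0 // -{}ss.
elim: s sn {Es} => [|w s IH] sn.
  by rewrite big_nil hornerC expr0 /normsqc /= expr1n expr0n addr0.
rewrite big_cons hornerM normsqcM /= (exprS _ (size s)).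
rewrite ler_pM ?exprn_ge0 ?sqr_ge0 //; last first.
  by apply: IH => v vs; apply: sn; rewrite inE vs orbT.
have := sn w (mem_head _ _); rewrite hornerXsubC.
case: (z) z0 (w) => a b /= b0 [u v] /= v0; rewrite /normsqc /=.
have h : 0 <= b * - v by rewrite mulr_ge0 // oppr_ge0 ltW.
have := sqr_ge0 (a - u); have := sqr_ge0 v; lra.
Qed.

(** A bound relative to 1 + |z|^2 controls the whole unbounded half plane at once, without
    compactness. *)
Lemma lower_bound_factor (w : C) : complex.Im w < 0 ->
  exists2 c : R, 0 < c & forall z, 0 <= complex.Im z ->
    c * (1 + normsqc z) <= normsqc (z - w).
Proof.
case: w => u v /= v0.
have v2 : 0 < v ^+ 2 by rewrite lt0r sqrf_eq0 sqr_ge0 andbT lt_eqF.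
have M0 : 0 < 2 + (1 + 2 * u ^+ 2) / v ^+ 2.
  by rewrite ltr_wpDr // mulr_ge0 ?invr_ge0 ?ltW //; have := sqr_ge0 u; lra.
(* With q = (1 + 2 u^2) / v^2, the term q v^2 supplies 1 + 2 u^2. Then 2 (a - u)^2 + 2 u^2 >= a^2,
   and 2 (b - v)^2 >= b^2 because b >= 0 > v. *)
exists (2 + (1 + 2 * u ^+ 2) / v ^+ 2)^-1.
  by rewrite invr_gt0.
move=> [a b] /= b0; rewrite ler_pdivrMl // /normsqc /=.
set q := (1 + 2 * u ^+ 2) / v ^+ 2.
have Eq : q * v ^+ 2 = 1 + 2 * u ^+ 2 by rewrite /q; field; rewrite lt_eqF.
have q0 : 0 <= q.
  by rewrite mulr_ge0 ?invr_ge0 ?ltW //; have := sqr_ge0 u; lra.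
clearbody q.
have h : 0 <= q * (a - u) ^+ 2 by rewrite mulr_ge0 ?sqr_ge0.
have h' : 0 <= q * (b * (b - 2 * v)).
  by rewrite mulr_ge0 // mulr_ge0 //; lra.
have -> : (2 + q) * ((a - u) ^+ 2 + (b - v) ^+ 2) =
  2 * (a - u) ^+ 2 + 2 * (b - v) ^+ 2 + q * (a - u) ^+ 2 +
  q * (b * (b - 2 * v)) + q * v ^+ 2 by ring.
rewrite Eq; have := sqr_ge0 (a - 2 * u); nra.
Qed.

Lemma lower_bound_open P k : size P = k.+1 ->
  (forall w, 0 <= complex.Im w -> P.[w] != 0) ->
  exists2 c : R, 0 < c & forall z, 0 <= complex.Im z ->
    c * (1 + normsqc z) ^+ k <= normsqc P.[z].
Proof.
move=> sP nr; have [s [Es ss sn]] := lower_half_plane_split sP nr.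
have lP : lead_coef P != 0 by rewrite lead_coef_eq0 -size_poly_eq0 sP.
suff [c c0 H] : exists2 c : R, 0 < c & forall z, 0 <= complex.Im z ->
    c * (1 + normsqc z) ^+ size s <= normsqc (\prod_(z <- s) ('X - z%:P)).[z].
  exists (normsqc (lead_coef P) * c); first by rewrite mulr_gt0 ?normsqc_gt0.
  move=> z z0; rewrite {2}Es hornerZ normsqcM -mulrA -ss.
  by rewrite ler_wpM2l ?normsqc_ge0 ?H.
elim: s sn {Es ss} => [|w s IH] sn.
  exists 1 => // z _; rewrite big_nil hornerC expr0.
  by rewrite /normsqc /= expr1n expr0n addr0 mulr1.
have [c c0 Hc] := lower_bound_factor (sn w (mem_head _ _)).
have [|c' c'0 Hc'] := IH; first by move=> v vs; apply: sn; rewrite inE vs orbT.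
exists (c * c'); first exact: mulr_gt0.
move=> z z0; rewrite big_cons hornerM normsqcM /= exprS mulrACA.
have z1 : 0 <= 1 + normsqc z by have := normsqc_ge0 z; lra.
rewrite ler_pM ?(mulr_ge0, exprn_ge0) ?(ltW c0) ?(ltW c'0) //.
  by rewrite hornerXsubC Hc.
exact: Hc'.
Qed.

Lemma horner_bounded (a : {poly C}) (b0 : R) : exists2 M : R, 0 <= M &
  forall b : R, `|b - b0| <= 1 -> normsqc a.[rc b] <= M.
Proof.
elim/poly_ind: a => [|a c [M M0 IH]].
  by exists 0 => // b _; rewrite horner0 /normsqc /= expr0n addr0.
have K0 : 0 <= (`|b0| + 1) ^+ 2 by exact: sqr_ge0.
exists (2 * (M * (`|b0| + 1) ^+ 2) + 2 * normsqc c).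
  by rewrite addr_ge0 // mulr_ge0 // ?mulr_ge0 ?normsqc_ge0.
move=> b hb; rewrite hornerMXaddC.
apply: le_trans (normsqcD _ _) _; rewrite lerD2r ler_wpM2l // normsqcM.
rewrite ler_pM ?normsqc_ge0 ?IH // normsqc_real.
rewrite -(real_normK (num_real b)) lerXn2r ?nnegrE ?normr_ge0 //.
by have := ler_normD (b - b0) b0; rewrite subrK; lra.
Qed.

Lemma horner_lipschitz (a : {poly C}) (b0 : R) : exists2 M : R, 0 <= M &
  forall b : R, `|b - b0| <= 1 ->
    normsqc (a.[rc b] - a.[rc b0]) <= M * (b - b0) ^+ 2.
Proof.
have /factor_theorem[q Eq] : root (a - a.[rc b0]%:P) (rc b0).
  by rewrite /root !hornerE subrr.
have [M M0 HM] := horner_bounded q b0; exists M => // b hb.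
have -> : a.[rc b] - a.[rc b0] = (a - a.[rc b0]%:P).[rc b] by rewrite !hornerE.
rewrite Eq hornerM normsqcM hornerXsubC -rmorphB normsqc_real.
by rewrite ler_wpM2r ?sqr_ge0 // HM.
Qed.

(** The outer variable of [B] is z and the inner one is b. Each coefficient in z is Lipschitz in b
    near [b0], and the degree in z is at most k, whence the growth factor (1 + |z|^2)^k. *)
Lemma bivariate_lipschitz (B : {poly {poly C}}) k (b0 : R) :
  (size B <= k.+1)%N -> exists2 M : R, 0 <= M &
  forall (b : R) z, `|b - b0| <= 1 ->
    normsqc (B.[z%:P].[rc b] - B.[z%:P].[rc b0]) <=
    M * (b - b0) ^+ 2 * (1 + normsqc z) ^+ k.
Proof.
elim/poly_ind: B k => [|B c IH] k sB.
  exists 0 => // b z _; rewrite !horner0 subrr !mul0r.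
  by rewrite /normsqc /= expr0n addr0.
have [Mc Mc0 Hc] := horner_lipschitz c b0.
have X1 (z : C) j : 1 <= (1 + normsqc z) ^+ j.
  by rewrite exprn_ege1 // lerDl normsqc_ge0.
case: k sB => [|k] sB.
  have B0 : B = 0.
    apply/eqP; rewrite -size_poly_eq0; move: sB; rewrite size_MXaddC.
    by case: eqP => [->|_]; rewrite ?size_poly0 //= ltnS leqn0.
  exists Mc => // b z hb; rewrite B0 mul0r add0r !hornerC expr0 mulr1.
  exact: Hc.
have [|M M0 HM] := IH k.
  by move: sB; rewrite size_MXaddC; case: eqP => [->|_]; rewrite ?size_poly0.
exists (2 * M + 2 * Mc); first by rewrite addr_ge0 // mulr_ge0.
move=> b z hb; rewrite !hornerMXaddC !hornerD !hornerM !hornerC.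
rewrite opprD addrACA -mulrBl; apply: le_trans (normsqcD _ _) _.
rewrite normsqcM [_ ^+ k.+1]exprS.
have h1 := HM b z hb; have h2 := Hc b hb; have z0 := normsqc_ge0 z.
have D0 := sqr_ge0 (b - b0); set D := (b - b0) ^+ 2 in h1 h2 D0 *.
have X0 := X1 z k; set X := (1 + normsqc z) ^+ k in h1 X0 *.
clearbody D X.
have h3 := ler_wpM2r z0 h1.
have MD0 : 0 <= M * D * X by rewrite !mulr_ge0 //; lra.
have h4 : 0 <= Mc * D * (X * (1 + normsqc z) - 1).
  by rewrite !mulr_ge0 //; nra.
by lra.
Qed.

Lemma small_sqr (M c : R) : 0 <= M -> 0 < c ->
  exists2 dl : R, 0 < dl & forall b, `|b| < dl -> `|b| <= 1 /\ M * b ^+ 2 < c.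
Proof.
move=> M0 c0; have M1 : 0 < M + 1 by lra.
have cM : 0 < c / (M + 1) by rewrite divr_gt0.
exists (Num.min 1 (c / (M + 1))); first by rewrite lt_min ltr01.
move=> b; rewrite lt_min => /andP[/ltW b1 bc]; split => //.
rewrite -(real_normK (num_real b)).
have h : `|b| * (M + 1) < c by rewrite -ltr_pdivlMr.
have h' : 0 <= M * `|b| * (1 - `|b|) by rewrite !mulr_ge0 // subr_ge0.
have := normr_ge0 b; lra.
Qed.

End ComplexBounds.

(** * Tracking zeros in the upper half plane *)

Section Garding.
Variables (R : realType) (d n : nat) (p : mpoly d R).
Hypothesis hp : p \is ishomog1 n mdeg.
Local Notation C := (complex R).
Local Notation rc := (real_complex R).
Implicit Types (x e : 'rV[R]_d) (a b c : 'I_d -> C).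

Lemma mmap_complex_line x e (t : C) :
  mmap rc (fun j => rc (x 0 j) + rc (e 0 j) * t) p =
  (map_poly rc (line_poly p x e)).[t].
Proof.
rewrite -(horner_mmap_line rc p (fun j => rc (x 0 j)) (fun j => rc (e 0 j))).
congr (_.[t]); rewrite /line_poly (rmorph_mmap polyC (map_poly rc)).
apply: mmap_eq => [r|j] /=; first by rewrite map_polyC.
by rewrite rmorphD rmorphM /= !map_polyC map_polyX.
Qed.

Lemma mmap_complex_real x :
  mmap rc (fun j => rc (x 0 j)) p = rc (peval p x).
Proof. by rewrite /peval /meval (rmorph_mmap idfun rc). Qed.

Lemma hyperbolic_complex_neq0 x e (t : C) : hyperbolic p e ->
  complex.Im t != 0 -> mmap rc (fun j => rc (x 0 j) + rc (e 0 j) * t) p != 0.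
Proof.
move=> [_ rr] t0; rewrite mmap_complex_line; apply: contraNneq t0 => /rootP.
by move/rr => ->.
Qed.

Let fam a b c (s : R) (z : C) := mmap rc (fun j => a j + rc s * b j + c j * z) p.

(** The leading coefficient p(c) does not depend on s, so the degree in z stays n and no zero
    escapes to infinity. *)
Lemma family_poly a b c s : mmap rc c p != 0 -> exists P : {poly C},
  [/\ size P = n.+1, P`_n = mmap rc c p & forall z, P.[z] = fam a b c s z].
Proof.
move=> c0; have [sP Pn] := size_coef_mmap_line rc (fun j => a j + rc s * b j) c hp.
eexists; split; last by move=> z; exact: horner_mmap_line.
- apply/eqP; rewrite eqn_leq sP ltnNge; apply: contra c0 => sP'.
  by rewrite -Pn nth_default.
- exact: Pn.
Qed.

Lemma family_lipschitz a b c (s0 : R) : exists2 M : R, 0 <= M &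
  forall (s : R) z, `|s - s0| <= 1 ->
    normsqc (fam a b c s z - fam a b c s0 z) <=
    M * (s - s0) ^+ 2 * (1 + normsqc z) ^+ n.
Proof.
have [sB _] := size_coef_mmap_line (polyC \o rc)
  (fun j => (a j)%:P + (b j)%:P * 'X) (fun j => (c j)%:P) hp.
have [M M0 HM] := bivariate_lipschitz s0 sB; exists M => // s z hs.
have E (r : R) : (mmap (polyC \o (polyC \o rc)) (fun j =>
    ((a j)%:P + (b j)%:P * 'X)%:P + ((c j)%:P)%:P * 'X) p).[z%:P].[rc r] =
    fam a b c r z.
  rewrite horner_mmap_line -[LHS]/(horner_eval (rc r) _).
  rewrite (rmorph_mmap (polyC \o rc) (horner_eval (rc r))).
  apply: mmap_eq => [u|j] /=; rewrite /horner_eval ?hornerC //.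
  by rewrite !hornerE mulrC.
by rewrite -!E; exact: HM.
Qed.

(** The lower bound at [s0] and the perturbation bound grow alike, as (1 + |z|^2)^n, so a small
    change of s cannot create a zero anywhere in the half plane. *)
Lemma family_open a b c s0 : mmap rc c p != 0 ->
  (forall z, 0 <= complex.Im z -> fam a b c s0 z != 0) ->
  exists2 dl : R, 0 < dl & forall s, `|s - s0| < dl ->
    forall z, 0 <= complex.Im z -> fam a b c s z != 0.
Proof.
move=> c0 nz; have [P [sP _ EP]] := family_poly a b s0 c0.
have [|k k0 Hk] := lower_bound_open sP.
  by move=> w w0; rewrite EP nz.
have [M M0 HM] := family_lipschitz a b c s0.
have [dl dl0 Hdl] := small_sqr M0 k0; exists dl => // s sdl z z0.
have [s1 Ms] := Hdl _ sdl; apply: contraTneq (HM s z s1) => ->.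
rewrite sub0r normsqcN -ltNge -EP; apply: lt_le_trans (Hk z z0).
by rewrite ltr_pM2r // exprn_gt0 // ltr_wpDr // normsqc_ge0.
Qed.

(** If the polynomial at s had no zero in the closed half plane, [lower_bound_closed] would bound
    its value at [z0] below uniformly in s, whereas that value tends to 0 as s tends to [s0]. *)
Lemma family_closed a b c s0 (z0 : C) : mmap rc c p != 0 -> 0 < complex.Im z0 ->
  fam a b c s0 z0 = 0 -> exists2 dl : R, 0 < dl & forall s, `|s - s0| < dl ->
    exists2 z, 0 <= complex.Im z & fam a b c s z = 0.
Proof.
move=> c0 Iz0 fz0; have [M M0 HM] := family_lipschitz a b c s0.
have M0' : 0 <= M * (1 + normsqc z0) ^+ n.
  by rewrite mulr_ge0 // exprn_ge0 // addr_ge0 // normsqc_ge0.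
have k0 : 0 < normsqc (mmap rc c p) * (complex.Im z0 ^+ 2) ^+ n.
  by rewrite mulr_gt0 ?normsqc_gt0 // exprn_gt0 // exprn_gt0.
have [dl dl0 Hdl] := small_sqr M0' k0; exists dl => // s sdl.
have [s1 Ms] := Hdl _ sdl; apply: contrapT => H.
have nz w : 0 <= complex.Im w -> fam a b c s w != 0.
  by move=> w0; apply/eqP => fw; apply: H; exists w.
have [P [sP Pn EP]] := family_poly a b s c0.
have nzP w : 0 <= complex.Im w -> P.[w] != 0 by rewrite EP; exact: nz.
have := lower_bound_closed sP nzP (ltW Iz0); rewrite Pn EP => lb.
have := HM s z0 s1; rewrite fz0 subr0 mulrAC => h1.
by have := lt_le_trans Ms (le_trans lb h1); rewrite ltxx.
Qed.

(** The set [S] of parameters s without zero in the closed upper half plane is nonempty, open and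
    closed in the real line. *)
Lemma garding_half_plane x e v : hyperbolic p e ->
  (forall j, (j <= n)%N -> 0 < (line_poly p v e)`_j) ->
  forall s z, 0 <= complex.Im z ->
    fam (fun j => rc (e 0 j) * 'i%C) (fun j => rc (x 0 j)) (fun j => rc (v 0 j)) s z
    != 0.
Proof.
move=> he vpos; set F := fam _ _ _.
have c0 : mmap rc (fun j => rc (v 0 j)) p != 0.
  rewrite mmap_complex_real fmorph_eq0 (peval_line_poly _ _ e).
  by rewrite gt_eqF // vpos.
pose S := [set s | forall z, 0 <= complex.Im z -> F s z != 0].
(* For real z = r the value is p(s x + r v + i e), and i is not a root of the real-rooted polynomial
   along e. *)
have real_neq0 s z : complex.Im z = 0 -> F s z != 0.
  case: z => r y /= y0; rewrite {}y0.
  have := @hyperbolic_complex_neq0 (s *: x + r *: v) e 'i%C he.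
  rewrite /= oner_eq0 => /(_ isT); congr (_ != 0).
  apply: mmap_eq => // j; rewrite !mxE /F rmorphD !rmorphM /=.
  by rewrite -[Complex r 0]/(rc r); ring.
have S0 : S 0.
  move=> z z0; have [Ez|zn0] := eqVneq z 0; first by rewrite Ez real_neq0.
  (* By homogeneity p(i e + z v) = z^n p(v + (i/z) e). A zero makes i/z a real root m, negative
     since all coefficients at v are positive; then i = m z forces Im z < 0. *)
  have -> : F 0 z = z ^+ n *
      mmap rc (fun j => rc (v 0 j) + rc (e 0 j) * ('i%C / z)) p.
    rewrite -(mmap_homog rc _ _ hp); apply: mmap_eq => // j.
    by rewrite rmorph0 mul0r addr0; field.
  rewrite mulf_neq0 ?expf_neq0 // mmap_complex_line.
  apply/negP => /eqP/rootP rt.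
  have [_ /(_ v)/(_ _ rt)] := he.
  case Ew: ('i%C / z) rt => [m y] /= rt y0; rewrite {}y0 in Ew rt.
  have /eqP qm : (line_poly p v e).[m] == 0.
    by rewrite -(fmorph_eq0 rc) -horner_map; apply/eqP/rootP.
  have qge0 j : 0 <= (line_poly p v e)`_j.
    have [/vpos/ltW//|nj] := leqP j n.
    by rewrite nth_default // (leq_trans (size_line_poly _ _ hp)).
  have m0 : m < 0.
    rewrite ltNge; apply/negP => m0; have := horner_ge_coef0 qge0 m0.
    by rewrite qm leNgt vpos.
  have : 'i%C = rc m * z by rewrite -[rc m]Ew divfK.
  case: (z) z0 => a b /= b0 [_]; rewrite mul0r addr0 => E1.
  by have := nmulr_rle0 b m0; rewrite -E1 b0 ler10.
have Sopen : open S.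
  rewrite openE => s Ss; have [dl dl0 H] := family_open c0 Ss.
  apply/nbhs_normP; exists dl => //= t /=; rewrite distrC => /H; exact.
have Sclosed : closed S.
  rewrite -openC openE => s nSs.
  (* Zeros on the real axis being excluded, a zero in the closed half plane lies strictly above the
     axis, as [family_closed] requires. *)
  have [z z0 Fz] : exists2 z, 0 < complex.Im z & F s z = 0.
    apply: contrapT => H; apply: nSs => z z0; apply/eqP => Fz; apply: H.
    exists z => //; rewrite lt0r z0 andbT.
    by apply/eqP => /(@real_neq0 s); rewrite Fz eqxx.
  have [dl dl0 H] := family_closed c0 z0 Fz.
  apply/nbhs_normP; exists dl => //= t /=; rewrite distrC => /H[w w0 Fw] St.
  by have := St w w0; rewrite (Fw : F t w = 0) eqxx.
have RT : connected [set: R] by apply/connected_intervalP.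
have ST : S = setT.
  apply: RT; first by exists 0.
  - by exists S; rewrite ?setTI.
  - by exists S; rewrite ?setTI.
by move=> s z z0; have Ss : S s; [rewrite ST | exact: Ss].
Qed.

(** A root of p(y + z v) above the axis would survive, with Im z >= 0, as a zero of p(y + s i e + z
    v) for small s > 0. Dividing by s contradicts [garding_half_plane]; conjugation excludes roots
    below the axis. *)
Lemma garding e v : hyperbolic p e ->
  (forall j, (j <= n)%N -> 0 < (line_poly p v e)`_j) -> hyperbolic p v.
Proof.
move=> he vpos; have pv : 0 < peval p v by rewrite (peval_line_poly _ _ e) vpos.
have c0 : mmap rc (fun j => rc (v 0 j)) p != 0.
  by rewrite mmap_complex_real fmorph_eq0 gt_eqF.
split=> // y.
have upper (z : C) : root (map_poly rc (line_poly p y v)) z -> complex.Im z <= 0.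
  move=> /rootP; rewrite -mmap_complex_line => rz.
  rewrite leNgt; apply/negP => z0.
  have := @family_closed (fun j => rc (y 0 j)) (fun j => rc (e 0 j) * 'i%C)
    (fun j => rc (v 0 j)) 0 z c0 z0.
  case=> [|dl dl0 /(_ (dl / 2))].
    by rewrite -rz; apply: mmap_eq => // j; rewrite rmorph0 mul0r addr0.
  have s0 : 0 < dl / 2 by rewrite divr_gt0.
  rewrite subr0 gtr0_norm // => -[|w w0 Fw]; first by lra.
  set s := dl / 2 in s0 Fw *.
  have sC : rc s != 0 by rewrite fmorph_eq0 gt_eqF.
  have W0 : 0 <= complex.Im (rc s^-1 * w).
    by case: (w) w0 => a b /= b0; rewrite mul0r addr0 mulr_ge0 // invr_ge0 ltW.
  have := garding_half_plane y he vpos s^-1 W0.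
  apply/negP/negPn; move/eqP: Fw.
  have -> : fam (fun j => rc (y 0 j)) (fun j => rc (e 0 j) * 'i%C)
      (fun j => rc (v 0 j)) s w = rc s ^+ n *
    fam (fun j => rc (e 0 j) * 'i%C) (fun j => rc (y 0 j)) (fun j => rc (v 0 j))
      s^-1 (rc s^-1 * w).
    rewrite -(mmap_homog rc _ _ hp); apply: mmap_eq => // j.
    by rewrite fmorphV; field.
  by rewrite mulf_eq0 expf_eq0 (negPf sC) andbF.
move=> z rz; apply/eqP; rewrite eq_le upper //=.
have /upper : root (map_poly rc (line_poly p y v)) (conjc z).
  rewrite -complex_root_conj -map_poly_comp.
  by rewrite (eq_map_poly (_ : _ =1 rc)) // => r; apply: conjc_real.
by case: (z) => a b /=; rewrite oppr_le0.
Qed.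


End Garding.

(** * Hyperbolicity cones *)

Section PevalTopology.
Variables (R : realType) (d : nat).
Implicit Types (p : mpoly d R) (x e : 'rV[R]_d).

Lemma peval_continuous p : continuous (peval p).
Proof.
have cC (c : R) : continuous (fun _ : 'rV[R]_d => c) by exact: cst_continuous.
have cM (f g : 'rV[R]_d -> R) : continuous f -> continuous g ->
    continuous (fun x => f x * g x).
  by move=> cf cg x; exact: (continuousM (cf x) (cg x)).
have cD (f g : 'rV[R]_d -> R) : continuous f -> continuous g ->
    continuous (fun x => f x + g x).
  by move=> cf cg x; exact: (continuousD (cf x) (cg x)).
rewrite /peval /meval /mmap; elim: (msupp p : seq _) => [|m s IH].
  by under eq_fun do rewrite big_nil; exact: cC.
under eq_fun do rewrite big_cons.
apply: cD IH; apply: (cM (fun=> _)); first exact: cC.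
rewrite /mmap1; elim: (index_enum _) => [|j r IHr].
  by under eq_fun do rewrite big_nil; exact: cC.
under eq_fun do rewrite big_cons.
apply: (cM _ _ _ IHr); elim: (m j) => [|k IHk].
  by under eq_fun do rewrite expr0; exact: cC.
under eq_fun do rewrite exprS.
by apply: (cM _ _ _ IHk) => x; exact: coord_continuous.
Qed.

Lemma coef_line_poly_iter_mdir p x e k :
  (line_poly p x e)`_k = peval (iter k (mdir e) p) x / k`!%:R.
Proof.
by rewrite peval_iter_mdir -[X in X / _]mulr_natr mulfK // pnatr_eq0 -lt0n fact_gt0.
Qed.

Lemma coef_line_poly_continuous p e k : continuous (fun x => (line_poly p x e)`_k).
Proof.
under eq_fun do rewrite coef_line_poly_iter_mdir.
move=> x; apply: (@continuousM _ _ (peval _) (cst k`!%:R^-1)).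
  exact: peval_continuous.
exact: cst_continuous.
Qed.

Lemma line_continuous x e : continuous (fun t : R => x + t *: e).
Proof.
by move=> t; apply: cvgD; [exact: cvg_cst | exact: cvgZr_tmp].
Qed.

Lemma closure_ray (A : set 'rV[R]_d) x e :
  (forall t : R, 0 < t -> A (x + t *: e)) -> closure A x.
Proof.
move=> H B nB; have : \forall t \near 0^'+, B (x + t *: e).
  have : (fun t : R => x + t *: e) @ 0^'+ --> x.
    apply: cvg_at_right_filter.
    by have := @line_continuous x e 0; rewrite /continuous_at scale0r addr0.
  by move=> /(_ B nB).
move=> BA; have [t [Bt t0]] : exists t : R, B (x + t *: e) /\ 0 < t.
  have /filter_ex[t] : \forall t \near (0 : R)^'+, B (x + t *: e) /\ 0 < t.
    by apply: filterI BA _; exact: nbhs_right_gt.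
  by exists t.
by exists (x + t *: e); split; [exact: H | ].
Qed.

Lemma interior_ray (A : set 'rV[R]_d) x e : interior A x ->
  exists2 t : R, 0 < t & A (x - t *: e).
Proof.
move=> Ax; have BA : \forall t \near 0^'+, A (x + t *: - e).
  have : (fun t : R => x + t *: (- e)) @ 0^'+ --> x.
    apply: cvg_at_right_filter.
    by have := @line_continuous x (- e) 0; rewrite /continuous_at scale0r addr0.
  by move=> /(_ A Ax).
have /filter_ex[t [At t0]] : \forall t \near (0 : R)^'+, A (x + t *: - e) /\ 0 < t.
  by apply: filterI BA _; exact: nbhs_right_gt.
by exists t => //; rewrite -scalerN.
Qed.

End PevalTopology.

(** * Description of the cones by signs of coefficients *)

Section HyperbolicityCones.
Variables (R : realType) (d : nat).
Implicit Types (p : mpoly d R) (x y e v : 'rV[R]_d).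

(** Algebraic models of the open and closed cones of order k. Coefficients of index above the degree
    vanish, hence the bound n in the strict version. *)
Definition pos_cone p e n k :=
  [set x | forall j, (k <= j <= n)%N -> 0 < (line_poly p x e)`_j].

Definition nonneg_cone p e k :=
  [set x | forall j, (k <= j)%N -> 0 <= (line_poly p x e)`_j].

Lemma pos_cone_open p e n k : open (pos_cone p e n k).
Proof.
rewrite openE => x xpos.
have : \forall y \near x, forall j : 'I_n.+1, (k <= j)%N -> 0 < (line_poly p y e)`_j.
  apply: (@filter_forall _ _
    (fun (j : 'I_n.+1) y => (k <= j)%N -> 0 < (line_poly p y e)`_j) _ (nbhs_filter x)).
  move=> j.
  have [kj|jk] := leqP k j; last exact: nearW.
  have := @coef_line_poly_continuous R d p e j x.
  move=> /(_ [set r | 0 < r]) H.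
  suff : nbhs x (fun y => 0 < (line_poly p y e)`_j) by apply: filterS => y /= ? _.
  apply: H; apply: open_nbhs_nbhs; split; first exact: open_gt.
  by apply: xpos; rewrite kj -ltnS ltn_ord.
apply: filterS => y H j /andP[kj jn].
exact: (H (Ordinal (jn : (j < n.+1)%N))).
Qed.

Lemma nonneg_cone_closed p e k : closed (nonneg_cone p e k).
Proof.
have -> : nonneg_cone p e k = \bigcap_(j in [set j | (k <= j)%N])
    ((fun x => (line_poly p x e)`_j) @^-1` [set r | 0 <= r]).
  by apply/seteqP; split => x H j; exact: H.
apply: closed_bigI => j _; apply: (continuous_closedP _).1; last exact: closed_ge.
exact: coef_line_poly_continuous.
Qed.

Lemma coef_line_poly_iter p x e k j :
  (line_poly (iter k (mdir e) p) x e)`_j =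
  (line_poly p x e)`_(k + j) *+ (k + j) ^_ k.
Proof. by rewrite line_poly_iter_mdir coef_derivn. Qed.

Lemma coef_line_poly_gt0 p x e k j :
  (0 < (line_poly (iter k (mdir e) p) x e)`_j) = (0 < (line_poly p x e)`_(k + j)).
Proof. by rewrite coef_line_poly_iter pmulrn_lgt0 // ffact_gt0 leq_addr. Qed.

Lemma coef_line_poly_ge0 p x e k j :
  (0 <= (line_poly (iter k (mdir e) p) x e)`_j) = (0 <= (line_poly p x e)`_(k + j)).
Proof. by rewrite coef_line_poly_iter pmulrn_lge0 // ffact_gt0 leq_addr. Qed.

Section Hyperbolic.
Variables (n : nat) (p : mpoly d R) (e : 'rV[R]_d).
Hypotheses (hp : p \is ishomog1 n mdeg) (he : hyperbolic p e).

Lemma coef_line_poly_eq0 x j : (n < j)%N -> (line_poly p x e)`_j = 0.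
Proof. by move=> nj; rewrite nth_default // (leq_trans (size_line_poly _ _ hp)). Qed.

Lemma coef_line_poly_top_gt0 x : 0 < (line_poly p x e)`_n.
Proof. by rewrite (coef_line_poly_top _ _ hp); case: he. Qed.

Lemma size_line_poly_hyperbolic x : size (line_poly p x e) = n.+1.
Proof.
apply/eqP; rewrite eqn_leq (size_line_poly _ _ hp) ltnNge; apply/negP => sz.
by have := coef_line_poly_top_gt0 x; rewrite nth_default // ltxx.
Qed.

Lemma hyperbolic_iter_mdir k : (k <= n)%N -> hyperbolic (iter k (mdir e) p) e.
Proof.
move=> kn; split=> [|x].
  rewrite -(coef_line_poly_top 0 e (iter_mdir_homog e k hp)).
  by rewrite coef_line_poly_gt0 subnKC // coef_line_poly_top_gt0.
rewrite line_poly_iter_mdir; apply: real_rooted_derivn; first exact: (he.2).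
by rewrite size_line_poly_hyperbolic ltnS.
Qed.

Lemma direction_pos k : pos_cone p e n k e.
Proof.
move=> j /andP[_ jn]; rewrite coef_line_poly_iter_mdir divr_gt0 ?ltr0n ?fact_gt0 //.
by have [] := hyperbolic_iter_mdir jn.
Qed.

Lemma pos_nonneg k : pos_cone p e n k `<=` nonneg_cone p e k.
Proof.
move=> x H j kj; have [jn|nj] := leqP j n; last by rewrite coef_line_poly_eq0.
by rewrite ltW // H // kj.
Qed.

Lemma nonneg_coef_pos k x : (k <= n)%N -> nonneg_cone p e k x ->
  0 < (line_poly p x e)`_k -> pos_cone p e n k x.
Proof.
move=> kn H xk j /andP[kj jn]; rewrite -(subnKC kj) -coef_line_poly_gt0.
apply: real_rooted_coef_gt0.
- exact: (hyperbolic_iter_mdir kn).2.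
- by move=> l; rewrite coef_line_poly_ge0 H // leq_addr.
- by rewrite coef_line_poly_gt0 addn0.
- rewrite line_poly_iter_mdir ltnNge; apply/negP => sz.
  have : (line_poly (iter k (mdir e) p) x e)`_(n - k) = 0.
    by rewrite line_poly_iter_mdir nth_default // (leq_trans sz) // leq_sub2r.
  apply/eqP; rewrite gt_eqF // coef_line_poly_gt0 subnKC //.
  exact: coef_line_poly_top_gt0.
Qed.

(** Up to j!, the coefficient of index j at x + t e is the value at t of the j-th derivative of
    [line_poly p x e], a nonzero polynomial with nonnegative coefficients. *)
Lemma nonneg_shift k x t : nonneg_cone p e k x -> 0 < t ->
  pos_cone p e n k (x + t *: e).
Proof.
move=> H t0 j /andP[kj jn].
rewrite coef_line_poly_iter_mdir divr_gt0 ?ltr0n ?fact_gt0 //.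
rewrite -horner_line_poly; apply: horner_gt0 => // [l|].
  by rewrite coef_line_poly_ge0 H // (leq_trans kj) // leq_addr.
by apply: real_rooted_neq0; exact: (hyperbolic_iter_mdir jn).2.
Qed.

Lemma nonneg_coneE k : nonneg_cone p e k = closure (pos_cone p e n k).
Proof.
apply/seteqP; split => [x H|].
  by apply: (@closure_ray _ _ _ _ e) => t; exact: nonneg_shift.
rewrite [X in _ `<=` X](closure_id _).1; last exact: nonneg_cone_closed.
exact/closure_subset/pos_nonneg.
Qed.

Lemma interior_nonneg_cone k : interior (nonneg_cone p e k) = pos_cone p e n k.
Proof.
apply/seteqP; split => [x /(@interior_ray _ _ _ _ e)[t t0 H]|].
  by have := nonneg_shift H t0; rewrite subrK.
rewrite -open_subsetE; [exact: pos_nonneg | exact: pos_cone_open].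
Qed.

Lemma pos_cone_segment x s : pos_cone p e n 0 x -> 0 <= s -> s <= 1 ->
  0 < peval p (e + s *: (x - e)).
Proof.
move=> xpos; rewrite le_eqVlt => /predU1P[<- _|s0 s1].
  by rewrite scale0r addr0; case: he.
have -> : e + s *: (x - e) = s *: (x + ((1 - s) / s) *: e).
  by apply/rowP => j; rewrite !mxE; field; rewrite gt_eqF.
rewrite (peval_homog _ _ hp) mulr_gt0 ?exprn_gt0 // -horner_line_poly.
apply: lt_le_trans (horner_ge_coef0 _ _); first exact: xpos.
  by move=> j; exact: (pos_nonneg xpos).
by rewrite divr_ge0 ?subr_ge0 // ltW.
Qed.

(** Inside a connected subset of {p > 0}, the positive cone is open and, coinciding there with the
    nonnegative cone, also closed. Conversely, segments from e stay in {p > 0}. *)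
Lemma open_cone0E : open_cone p e 0 = pos_cone p e n 0.
Proof.
apply/seteqP; split => [x [B [Be Bpos cB Bx]]|x xpos].
  suff E : B `&` pos_cone p e n 0 = B by move: Bx; rewrite -E => -[].
  apply: cB; first by exists e; split => //; exact: direction_pos.
    by exists (pos_cone p e n 0) => //; exact: pos_cone_open.
  exists (nonneg_cone p e 0); first exact: nonneg_cone_closed.
  apply/seteqP; split => y [By Hy]; split => //; first exact: pos_nonneg.
  apply: nonneg_coef_pos => //; rewrite -peval_line_poly.
  exact: Bpos.
apply: (@connected_component_max _ _
    ((fun s : R => e + s *: (x - e)) @` [set s | 0 <= s <= 1])).
- by exists 0; rewrite /= ?lexx ?ler01 // scale0r addr0.
- by move=> _ [s /andP[s0 s1] <-]; exact: pos_cone_segment.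
- apply: connected_continuous_connected.
    apply/connected_intervalP => a b /= /andP[a0 a1] /andP[b0 b1] c /andP[ac cb].
    by rewrite (le_trans a0 ac) (le_trans cb b1).
  by apply: continuous_subspaceT; exact: line_continuous.
- by exists 1; rewrite /= ?lexx ?ler01 // scale1r addrC subrK.
Qed.

End Hyperbolic.
End HyperbolicityCones.

(** * Change of direction and convexity *)

Section Cones.
Variables (R : realType) (d : nat).
Implicit Types (n : nat).
Implicit Types (p : mpoly d R) (x y e v : 'rV[R]_d).

Lemma pos_cone_iter n p e k : (k <= n)%N ->
  pos_cone (iter k (mdir e) p) e (n - k) 0 = pos_cone p e n k.
Proof.
move=> kn; apply/seteqP; split => x H j jn.
  by rewrite -(@subnKC k j) -?coef_line_poly_gt0 ?H //; lia.
by rewrite coef_line_poly_gt0 H //; lia.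
Qed.

Lemma nonneg_cone_iter p e k :
  nonneg_cone (iter k (mdir e) p) e 0 = nonneg_cone p e k.
Proof.
apply/seteqP; split => x H j jn; last by rewrite coef_line_poly_ge0 H ?leq_addr.
by rewrite -(subnKC jn) -coef_line_poly_ge0 H.
Qed.

Lemma nonneg_coneS p e k l : (k <= l)%N -> nonneg_cone p e k `<=` nonneg_cone p e l.
Proof. by move=> kl x H j lj; rewrite H // (leq_trans kl). Qed.

(** Both positive cones are components of {p > 0}, and v lies in the component of e. *)
Lemma garding_pos_cone n p e v : p \is ishomog1 n mdeg -> hyperbolic p e ->
  pos_cone p e n 0 v ->
  [/\ hyperbolic p v, pos_cone p v n 0 = pos_cone p e n 0 &
      nonneg_cone p v 0 = nonneg_cone p e 0].
Proof.
move=> hp he vpos; have hv : hyperbolic p v.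
  by apply: (garding hp he) => j jn; exact: vpos.
have E : pos_cone p v n 0 = pos_cone p e n 0.
  rewrite -(open_cone0E hp hv) -(open_cone0E hp he).
  apply/esym/same_connected_component.
  by rewrite -/(open_cone p e 0) (open_cone0E hp he).
by split=> //; rewrite (nonneg_coneE hp hv) (nonneg_coneE hp he) E.
Qed.

(** Taking y itself as direction of hyperbolicity turns x + y into a shift along the direction. *)
Lemma nonneg_add_pos0 n p e x y : p \is ishomog1 n mdeg -> hyperbolic p e ->
  nonneg_cone p e 0 x -> pos_cone p e n 0 y -> pos_cone p e n 0 (x + y).
Proof.
move=> hp he Hx Hy; have [hy <- Ny] := garding_pos_cone hp he Hy.
by rewrite -[y in x + y]scale1r; apply: (nonneg_shift hp hy) => //; rewrite Ny.
Qed.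

Section Hyperbolic.
Variables (n : nat) (p : mpoly d R) (e : 'rV[R]_d).
Hypotheses (hp : p \is ishomog1 n mdeg) (he : hyperbolic p e).

Lemma open_coneE k : (k <= n)%N -> open_cone p e k = pos_cone p e n k.
Proof.
move=> kn; rewrite -pos_cone_iter //.
rewrite -(open_cone0E (iter_mdir_homog e k hp) (hyperbolic_iter_mdir hp he kn)).
rewrite /open_cone; congr (connected_component _ e).
by apply/seteqP; split => x /=; rewrite dir_derivE.
Qed.

Lemma closed_coneE k : (k <= n)%N -> closed_cone p e k = nonneg_cone p e k.
Proof. by move=> kn; rewrite /closed_cone open_coneE // -nonneg_coneE. Qed.

Lemma boundary_closed_coneE k : (k < n)%N ->
  boundary (closed_cone p e k) =
  [set x | nonneg_cone p e k x /\ (line_poly p x e)`_k = 0].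
Proof.
move=> kn; rewrite closed_coneE ?(ltnW kn) // /boundary (interior_nonneg_cone hp he).
rewrite -(closure_id _).1; last exact: nonneg_cone_closed.
apply/seteqP; split => x [Hx H]; split=> //.
  apply/eqP; rewrite eq_le Hx // andbT leNgt; apply/negP => c0.
  by apply: H; apply: (nonneg_coef_pos hp he) => //; exact: ltnW.
by move=> /(_ k); rewrite leqnn ltnW // H ltxx => /(_ isT).
Qed.

Lemma nonneg_add_pos k x y : (k <= n)%N ->
  nonneg_cone p e k x -> pos_cone p e n k y -> pos_cone p e n k (x + y).
Proof.
move=> kn; rewrite -pos_cone_iter // -nonneg_cone_iter.
exact: (nonneg_add_pos0 (iter_mdir_homog e k hp) (hyperbolic_iter_mdir hp he kn)).
Qed.

Lemma nonneg_add k x y : (k <= n)%N ->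
  nonneg_cone p e k x -> nonneg_cone p e k y -> nonneg_cone p e k (x + y).
Proof.
move=> kn Hx Hy; rewrite (nonneg_coneE hp he).
apply: (@closure_ray _ _ _ _ e) => t t0; rewrite -addrA.
by apply: nonneg_add_pos => //; apply: (nonneg_shift hp he).
Qed.

Lemma coef_line_poly_scale x s j : (j <= n)%N ->
  (line_poly p (s *: x) e)`_j = s ^+ (n - j) * (line_poly p x e)`_j.
Proof.
move=> jn; rewrite !coef_line_poly_iter_mdir mulrA.
by rewrite (peval_homog _ _ (iter_mdir_homog e j hp)).
Qed.

Lemma nonneg_scale k x s : 0 <= s -> nonneg_cone p e k x ->
  nonneg_cone p e k (s *: x).
Proof.
move=> s0 H j kj; have [jn|nj] := leqP j n; last by rewrite (coef_line_poly_eq0 _ hp).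
by rewrite coef_line_poly_scale // mulr_ge0 ?exprn_ge0 ?H.
Qed.

Lemma pos_scale k x s : 0 < s -> pos_cone p e n k x ->
  pos_cone p e n k (s *: x).
Proof.
move=> s0 H j /andP[kj jn].
by rewrite coef_line_poly_scale // mulr_gt0 ?exprn_gt0 // H // kj.
Qed.

End Hyperbolic.
End Cones.

(** * Boundary faces *)

Section Planes.
Variables (R : realType) (d n : nat) (q : mpoly d R).
Hypothesis hq : q \is ishomog1 n mdeg.
Implicit Types (x y : 'rV[R]_d).

(** A polynomial vanishing on a segment vanishes on its line, and homogeneity covers u + v != 0. A
    point with u + v = 0 is reached along direction x, which leaves this exceptional line at
    once. *)
Lemma peval_plane_eq0 x y :
  (forall t, 0 < t -> t < 1 -> peval q (t *: x + (1 - t) *: y) = 0) ->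
  forall u v, peval q (u *: x + v *: y) = 0.
Proof.
move=> H.
have L0 : line_poly q y (x - y) = 0.
  apply: poly_eq0_itv => t t0 t1; rewrite horner_line_poly -[RHS](H t t0 t1).
  by congr peval; apply/rowP => j; rewrite !mxE; ring.
have off u v : u + v != 0 -> peval q (u *: x + v *: y) = 0.
  move=> uv; have -> : u *: x + v *: y = (u + v) *: (y + (u / (u + v)) *: (x - y)).
    by apply/rowP => j; rewrite !mxE; field.
  by rewrite (peval_homog _ _ hq) -horner_line_poly L0 horner0 mulr0.
move=> u v; have [uv|/off//] := eqVneq (u + v) 0.
have L : line_poly q (u *: x + v *: y) x = 0.
  apply: poly_eq0_itv => t t0 _; rewrite horner_line_poly.
  have -> : u *: x + v *: y + t *: x = (u + t) *: x + v *: y.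
    by apply/rowP => j; rewrite !mxE; ring.
  by apply: off; rewrite addrAC uv add0r gt_eqF.
by rewrite (peval_line_poly _ _ x) L coef0.
Qed.

End Planes.

Section Lines.
Variables (R : realType) (d : nat).
Implicit Types (A : set 'rV[R]_d) (x y : 'rV[R]_d).

Lemma line_nbhs A x y (t0 : R) : open A -> A (x + t0 *: y) ->
  exists2 dl : R, 0 < dl & forall t, `|t - t0| < dl -> A (x + t *: y).
Proof.
move=> oA At0; have : nbhs (x + t0 *: y) A by apply: open_nbhs_nbhs.
move=> /(@line_continuous R d x y t0)/nbhs_normP[dl /= dl0 H].
by exists dl => // t ht; apply: H; rewrite /= distrC.
Qed.

Lemma convex_setP A x y (t : R) : convex_set A -> A x -> A y ->
  0 <= t -> t <= 1 -> A (t *: x + (1 - t) *: y).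
Proof.
move=> cA Ax Ay t0 t1.
have := cA x y (Itv01 t0 t1); rewrite !inE => /(_ Ax Ay).
by rewrite /conv /=.
Qed.

End Lines.

(** * Flat planes in the boundary of a derivative cone *)

Section BoundaryStructure.
Variables (R : realType) (d n : nat) (p : mpoly d R) (e : 'rV[R]_d).
Hypotheses (hp : p \is ishomog1 n mdeg) (he : hyperbolic p e).
Hypothesis pointed0 :
  forall V : {vspace 'rV[R]_d}, [set` V] `<=` nonneg_cone p e 0 -> V = 0%VS.
Implicit Types (x y a c : 'rV[R]_d).

Local Notation coef x j := (line_poly p x e)`_j.
Local Notation nonneg := (nonneg_cone p e).

(** Oddness kills the coefficient of index n-1. That of index n-2 is nonnegative, and the top one is
    positive, so Laguerre kills it and with it all lower ones; the whole line through x then lies in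
    the original cone. *)
Lemma nonneg_cone_pointed k x : (k + 2 <= n)%N ->
  nonneg k x -> nonneg k (- x) -> x = 0.
Proof.
case: n hp => [|[|m]] hpm; rewrite ?addn2 // !ltnS => km Hx HNx.
have rr := he.2 x; have sz := size_line_poly_hyperbolic hpm he x.
have top := coef_line_poly_top_gt0 hpm he x.
have cN j : (j <= m.+2)%N -> coef (- x) j = (-1) ^+ (m.+2 - j) * coef x j.
  by move=> jm; rewrite -scaleN1r (coef_line_poly_scale e hpm).
have c1 : coef x m.+1 = 0.
  apply/eqP; rewrite eq_le Hx ?(leqW km) // andbT.
  by have := HNx m.+1 (leqW km); rewrite cN // subSnn mulN1r oppr_ge0.
have c0 : coef x m = 0.
  apply/eqP; apply: contraT => cm.
  have hm : (0 < m.+1 < size (line_poly p x e))%N by rewrite sz /=; lia.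
  have := real_rooted_coef_gap rr hm c1 cm.
  by rewrite /= pmulr_llt0 // ltNge Hx.
have call j : (j <= m.+1)%N -> coef x j = 0.
  by apply: real_rooted_coef_eq0; rewrite ?sz.
have : (<[x]> = 0)%VS.
  apply: pointed0 => _ /vlineP[s ->] j _.
  have [jm|mj] := leqP j m.+2; last by rewrite (coef_line_poly_eq0 _ hpm).
  rewrite (coef_line_poly_scale e hpm) //.
  move: jm; rewrite leq_eqVlt => /predU1P[->|jm]; last by rewrite call // mulr0.
  by rewrite subnn mul1r ltW.
by move=> x0; have := memv_line x; rewrite x0 memv0 => /eqP.
Qed.

Lemma nonneg0_of_double_root k x : (k + 2 <= n)%N -> nonneg k.+1 x ->
  coef x k.+1 = 0 -> 0 <= coef x k -> nonneg 0 x.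
Proof.
move=> kn Hx x1 x0 j _.
have [jk|kj] := leqP j k.+1; last by apply: Hx; exact: ltnW.
rewrite (@real_rooted_coef_ge0 _ _ k (he.2 x)) //.
by rewrite (size_line_poly_hyperbolic hp he) ltnS -addn2.
Qed.

Lemma pos_of_simple_root k x : (k + 2 <= n)%N -> nonneg k.+1 x ->
  coef x k.+1 = 0 -> coef x k < 0 -> pos_cone p e n k.+2 x.
Proof.
move=> kn Hx x1 x0 j /andP[kj jn].
apply: (@real_rooted_coef_simple _ _ k (he.2 x)) => //.
  by rewrite (size_line_poly_hyperbolic hp he) ltnS -addn2.
by rewrite (size_line_poly_hyperbolic hp he) kj.
Qed.

(* Leaving a in the direction -c inside a plane where the (k+1)-st derivative
   vanishes, one exits the cone at a point where the k-th derivative does not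
   stay negative: otherwise 0 would be a simple root there, and a whole
   neighbourhood in the plane would still lie in the cone. *)
Lemma exit_point k a c : (k + 3 <= n)%N -> nonneg k.+1 a -> nonneg k.+1 c ->
  c != 0 -> (forall s, coef (a + s *: - c) k.+1 = 0) ->
  exists2 s : R, 0 <= s &
    nonneg k.+1 (a + s *: - c) /\ nonneg 0 (a + s *: - c).
Proof.
move=> kn Ha Hc c0 plane.
pose T := [set s : R | 0 <= s /\ nonneg k.+1 (a + s *: - c)].
have T0 : T 0 by split; rewrite ?lexx // scale0r addr0.
have nc : ~ nonneg k.+1 (- c).
  move=> HNc; move/eqP: c0; apply.
  by apply: nonneg_cone_pointed Hc HNc; move: kn; rewrite !addnS.
have oC : open (~` nonneg k.+1) by rewrite openC; exact: nonneg_cone_closed.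
have Tub : has_ubound T.
  (* For large s, rescaling a - s c by 1/s brings it close to -c, which has a neighbourhood outside
     the cone. *)
  have [|dl dl0 H] := @line_nbhs _ _ _ (- c) a 0 oC; first by rewrite scale0r addr0.
  exists (2 / dl) => s [s0 Hs]; rewrite leNgt; apply/negP => ds.
  have s_gt0 : 0 < s by apply: lt_trans ds; rewrite divr_gt0.
  apply: (H s^-1).
    rewrite subr0 gtr0_norm ?invr_gt0 // invf_plt ?posrE //.
    by apply: le_lt_trans ds; rewrite ler_pdivlMr // mulVf ?gt_eqF // ler1n.
  have -> : - c + s^-1 *: a = s^-1 *: (a + s *: - c).
    by apply/rowP => j; rewrite !mxE; field; rewrite gt_eqF.
  by apply: (nonneg_scale hp) => //; rewrite invr_ge0.
have supT : has_sup T by split => //; exists 0.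
have m0 : 0 <= sup T by apply: ub_le_sup.
have Tm : T (sup T).
  split=> //; apply: contrapT => Hm.
  have [dl dl0 H] := @line_nbhs _ _ _ a (- c) (sup T) oC Hm.
  have [s Ts ms] := sup_adherent dl0 supT.
  apply: (H s) Ts.2; rewrite distrC ger0_norm; first by rewrite ltrBlDr -ltrBlDl.
  by rewrite subr_ge0; exact: ub_le_sup.
exists (sup T) => //; split; first exact: Tm.2.
have kn2 : (k + 2 <= n)%N by apply: leq_trans kn; rewrite leq_add2l.
apply: (nonneg0_of_double_root kn2) (Tm.2) (plane _) _.
rewrite leNgt; apply/negP => neg.
have := pos_of_simple_root kn2 Tm.2 (plane _) neg.
move=> /(@line_nbhs _ _ _ a (- c) (sup T) (@pos_cone_open _ _ _ _ _ _))[dl dl0 H].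
have Ts : T (sup T + dl / 2).
  split; first by rewrite addr_ge0 // divr_ge0 // ltW.
  move=> j; rewrite leq_eqVlt => /predU1P[<-|kj]; first by rewrite plane.
  have Hpos : pos_cone p e n k.+2 (a + (sup T + dl / 2) *: - c).
    apply: H; rewrite addrAC subrr add0r gtr0_norm ?divr_gt0 //; lra.
  exact: (pos_nonneg hp Hpos).
have := ub_le_sup Tub Ts; lra.
Qed.

(** Leaving from a along -c gives b = a - s c in the original cone. If b is nonzero, leaving from c
    along -b gives c - r b there too; hence c, and then a = b + s c, are sums of points of that
    cone. *)
Lemma flat_plane k a c : (k + 3 <= n)%N -> nonneg k.+1 a -> nonneg k.+1 c ->
  c != 0 -> (forall u v, coef (u *: a + v *: c) k.+1 = 0) ->
  nonneg 0 a \/ exists2 s : R, 0 <= s & a = s *: c.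
Proof.
move=> kn Ha Hc c0 plane.
have [s|s s0 [Hb Hb0]] := exit_point kn Ha Hc c0.
  by rewrite scalerN -scaleNr -[a]scale1r plane.
set b := a + s *: - c in Hb Hb0.
have Ea : a = b + s *: c by rewrite /b scalerN subrK.
have [b0|b_neq0] := eqVneq b 0.
  by right; exists s => //; rewrite Ea b0 add0r.
left; have [r|r r0 [_ Hc0]] := exit_point kn Hc Hb b_neq0.
  rewrite -[RHS](plane (- r) (1 + r * s)); congr (coef _ _).
  by apply/rowP => j; rewrite !mxE; ring.
have Ec : nonneg 0 c.
  have -> : c = (c + r *: - b) + r *: b by rewrite scalerN subrK.
  by apply: (nonneg_add hp he) => //; apply: (nonneg_scale hp).
by rewrite Ea; apply: (nonneg_add hp he) => //; apply: (nonneg_scale hp).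
Qed.

End BoundaryStructure.

(** * Order of vanishing and segments in the boundary *)

Section Faces.
Variables (R : realType) (d n : nat) (p : mpoly d R).
Hypothesis hp : p \is ishomog1 n mdeg.
Implicit Types (x y e v : 'rV[R]_d).

(** In the original cone the coefficient of index k-1 is also nonnegative, which is the
    multiple-root case: p vanishes at x along e to order greater than k. *)
Lemma nonneg_boundary_coef_eq0 e k x : hyperbolic p e -> (k < n)%N ->
  nonneg_cone p e 0 x -> (line_poly p x e)`_k = 0 ->
  forall j, (j <= k)%N -> (line_poly p x e)`_j = 0.
Proof.
move=> he; case: k => [|k] kn Hx xk j; first by rewrite leqn0 => /eqP ->.
apply: (real_rooted_coef_ge0 (he.2 x)) => //; last exact: Hx.
- by rewrite (size_line_poly_hyperbolic hp he).
- by move=> l _; exact: Hx.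
Qed.

Lemma peval_ray_mono e x y t : hyperbolic p e -> nonneg_cone p e 0 x ->
  pos_cone p e n 0 y -> 0 <= t -> peval p x <= peval p (x + t *: y).
Proof.
move=> he Hx Hy t0; have [_ _ Ny] := garding_pos_cone hp he Hy.
rewrite (peval_line_poly p x y) -horner_line_poly horner_ge_coef0 // => j.
by rewrite -Ny in Hx; exact: Hx.
Qed.

(* With u = e - r v in the open cone, p (x + s r v) <= p (x + s e) = O(s^(k+1)),
   which bounds from below the order of vanishing of p along v. *)
Lemma boundary_coef_indep e v k x : hyperbolic p e -> pos_cone p e n 0 v ->
  (k < n)%N -> nonneg_cone p e 0 x -> (line_poly p x e)`_k = 0 ->
  (line_poly p x v)`_k = 0.
Proof.
move=> he Hv kn Hx xk; have [hv _ Nv] := garding_pos_cone hp he Hv.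
have Hxv : nonneg_cone p v 0 x by rewrite Nv.
have [r r0 Hu] : exists2 r : R, 0 < r & pos_cone p e n 0 (e - r *: v).
  apply/interior_ray/open_nbhs_nbhs; split; first exact: pos_cone_open.
  exact: direction_pos.
set K := (line_poly p x e).[1]; set c := (line_poly p x v)`_k.
have c0 : 0 <= c by exact: Hxv.
have K0 : 0 <= K by apply: horner_ge0 => // j; exact: Hx.
have bound s : 0 < s -> s <= 1 -> c * r ^+ k <= K * s.
  move=> s0 s1; rewrite -(ler_pM2r (exprn_gt0 k s0)) -mulrA -exprMn -mulrA -exprS.
  apply: (@le_trans _ _ (peval p (x + (r * s) *: v))).
    rewrite -horner_line_poly; apply: horner_ge_coef => [j|]; first exact: Hxv.
    by rewrite mulr_ge0 // ltW.
  apply: (@le_trans _ _ (peval p (x + s *: e))).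
    have -> : x + s *: e = x + (r * s) *: v + s *: (e - r *: v).
      by apply/rowP => j; rewrite !mxE; ring.
    apply: (peval_ray_mono he) (ltW s0) => //.
    apply: (nonneg_add hp he) => //; apply: (nonneg_scale hp).
      by rewrite mulr_ge0 // ltW.
    exact: (pos_nonneg hp Hv).
  rewrite -horner_line_poly; apply: horner_le_expr => //; last exact: ltW.
    by move=> j; exact: Hx.
  by move=> j; rewrite ltnS; exact: nonneg_boundary_coef_eq0.
have rk : 0 < r ^+ k by exact: exprn_gt0.
apply/eqP; rewrite eq_le c0 andbT leNgt; apply/negP => c_gt0.
have q0 : 0 < c * r ^+ k by exact: mulr_gt0.
move: bound; set q := c * r ^+ k in q0 * => bound; clearbody q.
have Kq : 0 < K + 1 + q by lra.
(* This test value of s lies in (0, 1] and turns the bound into q (K + 1 + q) <= K q, impossible for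
   q > 0. *)
have := bound (q / (K + 1 + q)); rewrite divr_gt0 // ler_pdivrMr // mulrA.
rewrite ler_pdivlMr // => /(_ isT) H.
have : q * (K + 1 + q) <= K * q by apply: H; lra.
have : 0 < q * (1 + q) by apply: mulr_gt0; lra.
lra.
Qed.

(** If one inner point of the segment were interior to the cone, every other inner point would be a
    positive multiple of it plus a nonnegative multiple of an endpoint, hence interior as well. *)
Lemma segment_boundary e k x y (t : R) : hyperbolic p e -> (k <= n)%N ->
  nonneg_cone p e k x -> nonneg_cone p e k y -> 0 < t -> t < 1 ->
  (line_poly p (t *: x + (1 - t) *: y) e)`_k = 0 ->
  forall s, 0 < s -> s < 1 -> (line_poly p (s *: x + (1 - s) *: y) e)`_k = 0.
Proof.
move=> he kn Hx Hy t0 t1 zk s s0 s1.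
have Hw : nonneg_cone p e k (s *: x + (1 - s) *: y).
  by apply: (nonneg_add hp he) => //; apply: (nonneg_scale hp) => //; lra.
apply/eqP; rewrite eq_le Hw // andbT leNgt; apply/negP => wk.
have {Hw wk} Hw := nonneg_coef_pos hp he kn Hw wk.
suff : pos_cone p e n k (t *: x + (1 - t) *: y).
  by move=> /(_ k); rewrite leqnn kn zk ltxx => /(_ isT).
have [ts|st] := leP t s.
  have -> : t *: x + (1 - t) *: y =
      (1 - t / s) *: y + (t / s) *: (s *: x + (1 - s) *: y).
    by apply/rowP => j; rewrite !mxE; field; rewrite gt_eqF.
  apply: (nonneg_add_pos hp he) => //.
    by apply: (nonneg_scale hp) => //; rewrite subr_ge0 ler_pdivrMr ?mul1r.
  by apply: (pos_scale hp) => //; rewrite divr_gt0.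
have s1' : 0 < 1 - s by lra.
have -> : t *: x + (1 - t) *: y =
    (1 - (1 - t) / (1 - s)) *: x + ((1 - t) / (1 - s)) *: (s *: x + (1 - s) *: y).
  by apply/rowP => j; rewrite !mxE; field; rewrite gt_eqF.
apply: (nonneg_add_pos hp he) => //.
  by apply: (nonneg_scale hp) => //; rewrite subr_ge0 ler_pdivrMr ?mul1r //; lra.
by apply: (pos_scale hp) => //; rewrite divr_gt0 //; lra.
Qed.

Lemma coef_plane_eq0 e k x y : (forall t, 0 < t -> t < 1 ->
    (line_poly p (t *: x + (1 - t) *: y) e)`_k = 0) ->
  forall u v : R, (line_poly p (u *: x + v *: y) e)`_k = 0.
Proof.
move=> H u v; have hq := iter_mdir_homog e k hp.
rewrite coef_line_poly_iter_mdir (peval_plane_eq0 hq) ?mul0r // => t t0 t1.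
by rewrite peval_iter_mdir H // mul0rn.
Qed.

End Faces.

Section ExtremalSegments.
Variables (R : realType) (d n : nat) (p : mpoly d R) (e : 'rV[R]_d).
Hypotheses (hp : p \is ishomog1 n mdeg) (he : hyperbolic p e).
Hypothesis pointed0 :
  forall V : {vspace 'rV[R]_d}, [set` V] `<=` nonneg_cone p e 0 -> V = 0%VS.
Implicit Types (x y z : 'rV[R]_d) (F : set 'rV[R]_d).

Lemma nonneg_cone_zero k : nonneg_cone p e k 0.
Proof.
rewrite -(scale0r e); apply: (nonneg_scale hp) => //.
exact: (pos_nonneg hp (direction_pos hp he (k := k))).
Qed.

(** This lets faces of the original cone be recognised as faces of the larger one. The plane spanned
    by x and the inner point z is flat, so by [flat_plane] x lies in the original cone or is a
    multiple of z, which does. *)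
Lemma segment_nonneg0 k x y (t : R) : (k + 2 <= n)%N ->
  nonneg_cone p e k x -> nonneg_cone p e k y -> 0 < t -> t < 1 ->
  nonneg_cone p e 0 (t *: x + (1 - t) *: y) ->
  (line_poly p (t *: x + (1 - t) *: y) e)`_k = 0 -> nonneg_cone p e 0 x.
Proof.
case: k => [//|k] kn Hx Hy t0 t1 Hz zk; set z := t *: x + _ in Hz zk.
have [z0|z0] := eqVneq z 0.
  suff -> : x = 0 by exact: nonneg_cone_zero.
  apply: (nonneg_cone_pointed hp he pointed0 kn Hx).
  have -> : - x = ((1 - t) / t) *: y - t^-1 *: z.
    by apply/rowP => j; rewrite !mxE; field; rewrite gt_eqF.
  rewrite z0 scaler0 subr0; apply: (nonneg_scale hp) Hy.
  by rewrite divr_ge0 //; lra.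
have k3 : (k + 3 <= n)%N by lia.
have kn' : (k.+1 <= n)%N by lia.
have plane := coef_plane_eq0 hp (segment_boundary hp he kn' Hx Hy t0 t1 zk).
have plane' (u v : R) : (line_poly p (u *: x + v *: z) e)`_k.+1 = 0.
  rewrite -[RHS](plane (u + v * t) (v * (1 - t))).
  by congr ((line_poly p _ e)`_ _); apply/rowP => j; rewrite !mxE; ring.
have Hz' := nonneg_coneS (leq0n k.+1) Hz.
have [//|[s s0 ->]] := flat_plane hp he pointed0 k3 Hx Hz' z0 plane'.
exact: (nonneg_scale hp).
Qed.

(* A point of the face outside the hyperbolicity cone spans a flat plane with
   any other point of the face, which flat_plane excludes. *)
Lemma boundary_face_ray k F z : (k + 3 <= n)%N ->
  face (nonneg_cone p e k.+1) F ->
  (forall x, F x -> (line_poly p x e)`_k.+1 = 0) ->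
  F z -> ~ nonneg_cone p e 0 z -> F = [set t *: z | t in [set t : R | 0 <= t]].
Proof.
move=> kn [FK cF eF] F0 Fz nz.
have zn0 : z != 0 by apply: contra_notN nz => /eqP ->; exact: nonneg_cone_zero.
apply/seteqP; split => [y Fy|_ [t /= t0 <-]].
  have [->|y0] := eqVneq y 0; first by exists 0; rewrite /= ?lexx // scale0r.
  have plane : forall u v : R, (line_poly p (u *: z + v *: y) e)`_k.+1 = 0.
    apply: (coef_plane_eq0 hp) => t t0 t1; apply: F0.
    by apply: convex_setP => //; exact: ltW.
  have [//|[s s0 Ez]] := flat_plane hp he pointed0 kn (FK _ Fz) (FK _ Fy) y0 plane.
  have sn0 : s != 0 by apply: contraNneq zn0 => E; rewrite Ez E scale0r.
  exists s^-1; first by rewrite /= invr_ge0.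
  by rewrite Ez scalerA mulVf // scale1r.
have t2 : 0 < t + 2 by lra.
(* Since t + 2 > 1, z lies strictly between 0 and (t + 2) z, so the face contains both ends, and t z
   lies between them. *)
have [F2 F00] : F ((t + 2) *: z) /\ F 0.
  apply: (eF _ _ (t + 2)^-1).
  - by apply: (nonneg_scale hp) (FK _ Fz); exact: ltW.
  - exact: nonneg_cone_zero.
  - by rewrite invr_gt0.
  - by rewrite invf_lt1 //; lra.
  - by rewrite scaler0 addr0 scalerA mulVf ?gt_eqF // scale1r.
have -> : t *: z = (t / (t + 2)) *: ((t + 2) *: z) + (1 - t / (t + 2)) *: 0.
  by rewrite scaler0 addr0 scalerA divfK // gt_eqF.
apply: convex_setP => //; first by rewrite divr_ge0 // ltW.
by rewrite ler_pdivrMr // mul1r; lra.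
Qed.

End ExtremalSegments.

(** * Independence of the direction and the face dichotomy *)

Theorem theorem1 (R : realType) (d n i : nat) (p : mpoly d R) (e0 : 'rV[R]_d)
    (hom_p : p \is ishomog1 n mdeg) (hyp_p : hyperbolic p e0)
    (reg_p : regular_cone (closed_cone p e0 0)) (le_i : (i + 2 <= n)%N) :
  (* (A) *)
  (forall e e' : 'rV[R]_d, open_cone p e0 0 e -> open_cone p e0 0 e' ->
     closed_cone p e0 0 `&` boundary (closed_cone p e i) =
     closed_cone p e0 0 `&` boundary (closed_cone p e' i)
     /\
     forall F : set 'rV[R]_d, face (closed_cone p e0 0) F ->
       boundary_face (closed_cone p e i) F ->
       boundary_face (closed_cone p e' i) F)
  /\
  (* (B) *)
  (forall e : 'rV[R]_d, open_cone p e0 0 e ->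
     forall F : set 'rV[R]_d, boundary_face (closed_cone p e i) F ->
       face (closed_cone p e0 0) F
       \/
       [/\ (0 < i)%N, ray F &
           forall x : 'rV[R]_d, F x -> x != 0 ->
             (open_cone p e i.+1 `\` closed_cone p e i.-1) x]).
Proof.
have in_ : (i < n)%N by lia.
(* Everything known about [e0], including pointedness, is transferred to an arbitrary direction of
   the open cone. *)
have G e : open_cone p e0 0 e -> [/\ hyperbolic p e,
    pos_cone p e n 0 = pos_cone p e0 n 0,
    closed_cone p e0 0 = nonneg_cone p e 0 &
    forall V : {vspace 'rV[R]_d}, [set` V] `<=` nonneg_cone p e 0 -> V = 0%VS].
  rewrite (open_cone0E hom_p hyp_p) => /(garding_pos_cone hom_p hyp_p)[he Pe Ne].
  have E : closed_cone p e0 0 = nonneg_cone p e 0.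
    by rewrite (closed_coneE hom_p hyp_p) ?Ne.
  by split=> // V; rewrite -E; exact: reg_p.2.
have sub e e' : open_cone p e0 0 e -> open_cone p e0 0 e' ->
    closed_cone p e0 0 `&` boundary (closed_cone p e i) `<=`
    closed_cone p e0 0 `&` boundary (closed_cone p e' i).
  move=> /G[he Pe Le _] Ce' x [Lx]; have [he' Pe' Le' _] := G e' Ce'.
  rewrite (boundary_closed_coneE hom_p he in_) => -[_ xi]; split=> //.
  rewrite (boundary_closed_coneE hom_p he' in_); split.
    by apply: nonneg_coneS (leq0n i) _ _; rewrite -Le'.
  apply: (boundary_coef_indep hom_p he) xi => //; last by rewrite -Le.
  by rewrite Pe -(open_cone0E hom_p hyp_p).
split=> [e e' Ce Ce'|e /G[he Pe Le pe] F [[FK cF eF] Fbd]].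
  split=> [|F [FL cF eF] [_ Fbd]]; first by apply/seteqP; split; exact: sub.
  have Fbd' : F `<=` boundary (closed_cone p e' i).
    by move=> x Fx; have [] := sub e e' Ce Ce' x (conj (FL x Fx) (Fbd x Fx)).
  have [he' Pe' Le' pe'] := G e' Ce'.
  split=> //; move: Fbd'; rewrite (boundary_closed_coneE hom_p he' in_) => Fbd'.
  rewrite (closed_coneE hom_p he' (ltnW in_)); split=> // [x /Fbd'[]//|].
  (* A segment of the larger cone with an inner point in F has both ends in the original cone, where
     F is a face. *)
  move=> x y t Hx Hy t0 t1 Fz; have [_ zi] := Fbd' _ Fz.
  have Lz : nonneg_cone p e' 0 (t *: x + (1 - t) *: y) by rewrite -Le'; exact: FL.
  apply: (eF x y t) => //; rewrite Le'.
    exact: (segment_nonneg0 hom_p he' pe' le_i Hx Hy t0 t1 Lz zi).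
  have Ez : t *: x + (1 - t) *: y = (1 - t) *: y + (1 - (1 - t)) *: x.
    by rewrite subKr addrC.
  rewrite Ez in Lz zi.
  by apply: (segment_nonneg0 hom_p he' pe' le_i Hy Hx _ _ Lz zi); lra.
rewrite (boundary_closed_coneE hom_p he in_) in Fbd.
have [FL|nFL] := pselect (F `<=` closed_cone p e0 0).
  left; split=> // x y t Lx Ly; apply: eF.
    rewrite (closed_coneE hom_p he (ltnW in_)).
    by apply: nonneg_coneS (leq0n i) _ _; rewrite -Le.
  rewrite (closed_coneE hom_p he (ltnW in_)).
  by apply: nonneg_coneS (leq0n i) _ _; rewrite -Le.
right; have [z Fz] : exists2 z, F z & ~ nonneg_cone p e 0 z.
  apply: contrapT => H; apply: nFL => z Fz; apply: contrapT; rewrite Le => nz.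
  by apply: H; exists z.
rewrite (closed_coneE hom_p he (ltnW in_)) in FK eF.
(* For i = 0 the cone is the original one, so z cannot lie outside it. *)
case: i le_i in_ FK eF Fbd {sub} => [|k] le_k kn FK eF Fbd nz.
  by case: nz; exact: FK.
have k3 : (k + 3 <= n)%N by lia.
have k2 : (k + 2 <= n)%N by lia.
have FR := boundary_face_ray hom_p he pe k3 (And3 FK cF eF)
  (fun x Fx => (Fbd x Fx).2) Fz nz.
split=> //.
  exists z => //; apply: contra_notN nz => /eqP ->.
  exact: (nonneg_cone_zero hom_p he).
move=> x Fx x0; have [Hx xk] := Fbd x Fx.
(* A nonzero point of the ray is a positive multiple of z, hence also outside the original cone. *)
have nx : ~ nonneg_cone p e 0 x.
  move=> Hx0; apply: nz; move: Fx; rewrite FR => -[s /= s0 Ex].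
  have sn0 : s != 0 by apply: contraNneq x0 => E; rewrite -Ex E scale0r.
  have -> : z = s^-1 *: x by rewrite -Ex scalerA mulVf // scale1r.
  by apply: (nonneg_scale hom_p) Hx0; rewrite invr_ge0.
(* This sign settles both claims: it excludes x from the closed cone of order i-1, and it makes 0 a
   simple root, which puts x in the open cone of order i+1. *)
have neg : (line_poly p x e)`_k < 0.
  rewrite ltNge; apply/negP => ge0; apply: nx.
  exact: (nonneg0_of_double_root hom_p he k2 Hx xk ge0).
split; first by rewrite (open_coneE hom_p he) //; exact: pos_of_simple_root.
rewrite /= (closed_coneE hom_p he); last by lia.
by move=> /(_ k (leqnn k)); rewrite leNgt neg.
Qed.
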